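(* There exist separable real Banach spaces $X$ and $Y$ (fixed, not depending on $\varepsilon$) such that the following two assertions hold. (i) For every $\varepsilon>0$ there is an injective map $f_\varepsilon: X\to Y$ satisfying $$0\leq \|f_\varepsilon(x)-f_\varepsilon(y)\|_Y-\|x-y\|_X\leq \varepsilon\qquad\text{for all }x,y\in X.$$ Moreover, $f_\varepsilon$ is uniformly continuous and its inverse $f_\varepsilon^{-1}:f_\varepsilon(X)\to X$, defined on its range, is $1$-Lipschitz. (ii) There is no isometric embedding $g:X\to Y$, whether or not $g$ is assumed linear; that is, there is no map $g:X\to Y$ with $\|g(x)-g(y)\|_Y=\|x-y\|_X$ for all $x,y\in X$. Furthermore, one may take $X=(\ell_2,\|\cdot\|_2)$ and $Y=\mathcal{F}_\omega(\ell_2)$ with $\omega(t)=\max\{t,\sqrt t\}$ for $t\ge 0$; that is, this specific pair $(X,Y)$ consists of separable real Banach spaces satisfying (i) and (ii).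
   Context: All Banach spaces are real; $\ell_2$ is the real Hilbert space of square-summable real sequences with its usual norm $\|\cdot\|_2$. Lipschitz-free spaces. Let $(M,d)$ be a pointed metric space with distinguished point $0\in M$. $\operatorname{Lip}_0(M)$ is the Banach space of all Lipschitz functions $h:M\to\mathbb{R}$ with $h(0)=0$, with norm $$\|h\|_{\operatorname{Lip}}=\sup\left\{\frac{|h(u)-h(v)|}{d(u,v)}: u,v\in M,\ u\neq v\right\}.$$ For $u\in M$, let $\delta_M(u)\in \operatorname{Lip}_0(M)^*$ be the evaluation functional $h\mapsto h(u)$. The Lipschitz-free space over $M$ is $$\mathcal{F}(M)=\overline{\operatorname{span}}\{\delta_M(u):u\in M\}\subseteq \operatorname{Lip}_0(M)^*,$$ the closure being in the dual norm, and $\mathcal{F}(M)$ carries the dual norm. If $\omega:[0,\infty)\to[0,\infty)$ is such that $d_\omega=\omega\circ d$ is a metric on $M$, then $\mathcal{F}_\omega(M)=\mathcal{F}(M,d_\omega)$, with the same distinguished point. In particular, for $\omega(t)=\max\{t,\sqrt t\}$, $\mathcal{F}_\omega(\ell_2)$ is the Lipschitz-free space over $\ell_2$ equipped with the metric $\rho(x,y)=\max\{\|x-y\|_2,\sqrt{\|x-y\|_2}\}$ and the distinguished point $0\in\ell_2$. *)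

(* Defs.v *)
From HB Require Import structures.
From mathcomp Require Import all_boot all_order all_algebra.
From mathcomp Require Import all_classical all_reals all_analysis.
From mathcomp Require Import ring lra.

Set Implicit Arguments.
Unset Strict Implicit.
Unset Printing Implicit Defensive.

Import Order.TTheory GRing.Theory Num.Theory.
Import numFieldNormedType.Exports.

Local Open Scope classical_set_scope.
Local Open Scope ring_scope.

Definition separable (T : topologicalType) : Prop :=
  exists2 D : set T, countable D & dense D.

(* A criterion for completeness of a space of functions normed by a gauge
   [P g e] ("the norm of [g] is at most [e]") that is closed under pointwise
   limits. *)
Lemma pointwise_complete (R : realType) (E : normedModType R) (T : Type)
    (ev : E -> T -> R) (P : (T -> R) -> R -> Prop) :
  injective ev ->
  (forall x y t, ev (x - y) t = ev x t - ev y t) ->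
  (forall t, exists2 C, 0 < C & forall x, `|ev x t| <= C * `|x|) ->
  (forall x e, 0 <= e -> `|x| <= e -> P (ev x) e) ->
  (forall g e, 0 <= e -> P g e -> exists2 x, ev x = g & `|x| <= e) ->
  (forall (F : set_system E) (h : E -> T -> R) g e, ProperFilter F -> 0 <= e ->
    (forall t, h x t @[x --> F] --> g t) ->
    (\forall x \near F, P (h x) e) -> P g e) ->
  forall F : set_system E, ProperFilter F -> cauchy F -> cvg F.
Proof.
move=> evI evB evC normP Pnorm Pcl F FF /cauchy_ballP Fc.
pose g t := lim (ev x t @[x --> F]).
have Fg t : ev x t @[x --> F] --> g t.
  suff : cvg (ev x t @[x --> F]) by [].
  apply/cauchy_cvgP/cauchy_ballP => e e0.
  have [C C0 HC] := evC t.
  have eC : 0 < e / C by rewrite divr_gt0.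
  rewrite near_map2; have H := Fc _ eC.
  apply: filterS H => -[x y] /=; rewrite -!ball_normE /= -evB => xy.
  by rewrite (le_lt_trans (HC _))// mulrC -ltr_pdivlMr.
have key e : 0 < e -> \forall x \near F, P (fun t => ev x t - g t) e.
  move=> e0; have /nearP_dep H := Fc _ e0.
  apply: filterS H => x Hx.
  apply: (Pcl F (fun y t => ev x t - ev y t)) => //.
  - exact: ltW.
  - by move=> t; apply: cvgB => //; exact: cvg_cst.
  - apply: filterS Hx => y; rewrite -ball_normE /= => /ltW xy.
    rewrite (_ : (fun t => _) = ev (x - y)); last by apply/funext => t; rewrite evB.
    by apply: normP => //; exact: ltW.
have [x0 /= Px0] := filter_ex (key _ ltr01).
have [z zE _] := Pnorm _ _ ler01 Px0.
have lE t : ev (x0 - z) t = g t by rewrite evB zE subKr.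
apply/cvg_ex; exists (x0 - z); apply/cvgrPdist_le => e e0.
apply: filterS (key _ e0) => x Px.
have [y yE ye] := Pnorm _ _ (ltW e0) Px.
have yx : y = x - (x0 - z).
  by apply: evI; apply/funext => t; rewrite yE evB lE.
by rewrite distrC -yx.
Qed.

Section ell2.
Variable R : realType.

Definition square_summable : {pred nat -> R^o} :=
  mem [set x : nat -> R^o | cvgn (series (fun n => x n ^+ 2))].

Lemma sum_sqr_nd (x : nat -> R) : nondecreasing_seq (series (fun n => x n ^+ 2)).
Proof.
apply/nondecreasing_seqP => n; rewrite /series /= big_nat_recr //= lerDl.
exact: sqr_ge0.
Qed.

Lemma square_summableP (x : nat -> R) :
  reflect (exists M, forall n, series (fun n => x n ^+ 2) n <= M)
          (x \in square_summable).
Proof.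
apply: (iffP idP) => [|[M xM]]; rewrite inE /=.
- move=> xc; exists (limn (series (fun n => x n ^+ 2))) => n.
  exact: nondecreasing_cvgn_le (@sum_sqr_nd x) xc n.
- apply: nondecreasing_is_cvgn (@sum_sqr_nd x) _.
  by exists M => _ [n _ <-].
Qed.

Lemma sum_sqrD (x y : nat -> R) a b : 0 < a -> 0 < b ->
  (forall n, series (fun n => x n ^+ 2) n <= a ^+ 2) ->
  (forall n, series (fun n => y n ^+ 2) n <= b ^+ 2) ->
  forall n, series (fun n => (x n + y n) ^+ 2) n <= (a + b) ^+ 2.
Proof.
move=> a0 b0 xa yb n.
apply: (@le_trans _ _ ((1 + b / a) * series (fun n => x n ^+ 2) n +
                       (1 + a / b) * series (fun n => y n ^+ 2) n)).
  rewrite /series /= !mulr_sumr -big_split /=; apply: ler_sum => i _.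
  rewrite -subr_ge0.
  have -> : (1 + b / a) * x i ^+ 2 + (1 + a / b) * y i ^+ 2 - (x i + y i) ^+ 2 =
            (b * x i - a * y i) ^+ 2 / (a * b).
    by field; rewrite !gt_eqF.
  by rewrite divr_ge0 ?sqr_ge0// mulr_ge0// ltW.
have -> : (a + b) ^+ 2 = (1 + b / a) * a ^+ 2 + (1 + a / b) * b ^+ 2.
  by field; rewrite !gt_eqF.
by apply: lerD; rewrite ler_wpM2l// addr_ge0// divr_ge0// ltW.
Qed.

Lemma square_summable_submod : submod_closed square_summable.
Proof.
split=> [|a x y /square_summableP[A xA] /square_summableP[B yB]].
  apply/square_summableP; exists 0 => n.
  by rewrite /series /= big1// => i _; rewrite expr0n.
pose c (M : R) := `|M| + 1.
have c0 M : 0 < c M by rewrite /c ltr_wpDl.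
have cM M : M <= c M ^+ 2.
  have := ler_norm M; have := normr_ge0 M; rewrite /c; nra.
have axA n : series (fun n => (a * x n) ^+ 2) n <= c (a ^+ 2 * A) ^+ 2.
  apply: le_trans (cM _); rewrite /series /=.
  under eq_bigr do rewrite exprMn.
  by rewrite -mulr_sumr ler_wpM2l ?sqr_ge0//; exact: xA.
apply/square_summableP; exists ((c (a ^+ 2 * A) + c B) ^+ 2) => n.
by apply: sum_sqrD => // m; exact: le_trans (yB m) (cM _).
Qed.

HB.instance Definition _ :=
  GRing.isSubmodClosed.Build R (nat -> R^o) square_summable square_summable_submod.

Definition ell2 : Type := {x : nat -> R^o | x \in square_summable}.

HB.instance Definition _ := SubType.copy ell2 {x | x \in square_summable}.
HB.instance Definition _ := [Choice of ell2 by <:].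
HB.instance Definition _ := [SubChoice_isSubLmodule of ell2 by <:].

Definition ell2_norm (x : ell2) : R :=
  Num.sqrt (limn (series (fun n => val x n ^+ 2))).

Lemma ell2_normP (x : ell2) e : 0 <= e ->
  ell2_norm x <= e <-> forall n, series (fun n => val x n ^+ 2) n <= e ^+ 2.
Proof.
move=> e0; have xc : cvgn (series (fun n => val x n ^+ 2)).
  by have := valP x; rewrite inE.
have l0 : 0 <= limn (series (fun n => val x n ^+ 2)).
  apply: (le_trans _ (nondecreasing_cvgn_le (@sum_sqr_nd (val x)) xc 0%N)).
  by rewrite /series /= big_nil.
rewrite /ell2_norm -(ler_pXn2r (_ : 0 < 2)%N) ?nnegrE ?sqrtr_ge0// sqr_sqrtr//.
split=> [le n|le].
  exact: le_trans (nondecreasing_cvgn_le (@sum_sqr_nd (val x)) xc n) le.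
by apply: limr_le => //; exact: nearW.
Qed.

Lemma ell2_norm_ge0 (x : ell2) : 0 <= ell2_norm x.
Proof. exact: sqrtr_ge0. Qed.

Lemma ell2_sum_le (x : ell2) e n : ell2_norm x <= e ->
  series (fun n => val x n ^+ 2) n <= e ^+ 2.
Proof.
move=> xe; have e0 := le_trans (ell2_norm_ge0 x) xe.
exact: (ell2_normP x e0).1.
Qed.

Lemma ell2_normD (x y : ell2) : ell2_norm (x + y) <= ell2_norm x + ell2_norm y.
Proof.
apply/ler_addgt0Pr => e e0; have x0 := ell2_norm_ge0 x; have y0 := ell2_norm_ge0 y.
have e20 : 0 < e / 2 by rewrite divr_gt0.
have -> : ell2_norm x + ell2_norm y + e =
  (ell2_norm x + e / 2) + (ell2_norm y + e / 2) by field.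
apply: (ell2_normP _ _).2; first by rewrite !addr_ge0// ltW.
apply: (@sum_sqrD (val x) (val y)); rewrite ?ltr_wpDl// => n;
  by apply: ell2_sum_le; rewrite lerDl ltW.
Qed.

Lemma ell2_normZ (a : R) (x : ell2) : ell2_norm (a *: x) = `|a| * ell2_norm x.
Proof.
have le (b : R) (z : ell2) : ell2_norm (b *: z) <= `|b| * ell2_norm z.
  apply: (ell2_normP _ _).2; first by rewrite mulr_ge0 ?ell2_norm_ge0.
  move=> n; rewrite exprMn real_normK ?num_real// /series /=.
  under eq_bigr do rewrite exprMn.
  rewrite -mulr_sumr ler_wpM2l ?sqr_ge0//.
  exact: ell2_sum_le.
apply/eqP; rewrite eq_le le /=.
have [->|a0] := eqVneq a 0; first by rewrite normr0 mul0r ell2_norm_ge0.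
rewrite -ler_pdivlMl ?normr_gt0// -normfV.
by rewrite -{1}[x]scale1r -(mulVf a0) -scalerA le.
Qed.

Lemma ell2_coord_le (x : ell2) n : `|val x n| <= ell2_norm x.
Proof.
rewrite -(ler_pXn2r (_ : 0 < 2)%N) ?nnegrE ?ell2_norm_ge0// real_normK ?num_real//.
have := @ell2_sum_le x _ n.+1 (lexx (ell2_norm x)).
rewrite /series /= big_nat_recr//=; apply: le_trans; rewrite lerDr.
by apply: sumr_ge0 => i _; exact: sqr_ge0.
Qed.

Lemma ell2_norm_eq0 (x : ell2) : ell2_norm x = 0 -> x = 0.
Proof.
move=> x0; apply/val_inj/funext => n; apply/eqP.
by have := ell2_coord_le x n; rewrite x0 normr_le0.
Qed.

HB.instance Definition _ :=
  Lmodule_isNormed.Build R ell2 ell2_normD ell2_normZ ell2_norm_eq0.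

Lemma ell2_complete (F : set_system ell2) : ProperFilter F -> cauchy F -> cvg F.
Proof.
apply: (@pointwise_complete R ell2 nat (fun x n => val x n)
  (fun g e => forall n, series (fun n => g n ^+ 2) n <= e ^+ 2)).
- exact: val_inj.
- by [].
- by move=> n; exists 1 => // x; rewrite mul1r; exact: ell2_coord_le.
- by move=> x e _ xe n; exact: ell2_sum_le.
- move=> g e e0 ge; have gP : g \in square_summable.
    by apply/square_summableP; exists (e ^+ 2).
  by exists (exist _ g gP : ell2) => //; apply: (ell2_normP _ _).2.
- move=> {}F h g e FF e0 hg hF n.
  apply: (@cvgr_to_le _ F FF _ (fun x => series (fun n => h x n ^+ 2) n)).
    apply: cvg_big => [|i _]; first exact: add_continuous.
    rewrite expr2; under eq_fun do rewrite expr2.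
    by apply: cvgM.
  by apply: filterS hF => x; exact.
Qed.

HB.instance Definition _ := Uniform_isComplete.Build ell2 ell2_complete.

End ell2.

Section dual.
Variables (R : realType) (V : normedModType R).

Definition bounded_functional : {pred V -> R^o} :=
  mem [set f : V -> R^o | linear f /\ continuous f].

Lemma bounded_functionalP (f : V -> R^o) :
  reflect (linear f /\ exists2 C, 0 <= C & forall x, `|f x| <= C * `|x|)
          (f \in bounded_functional).
Proof.
apply: (iffP idP) => [|[fl [C C0 fC]]]; rewrite inE /=.
- move=> [fl fc]; split=> //.
  pose g : {linear V -> R^o} := HB.pack f (GRing.isLinear.Build _ _ _ _ f fl).
  have /linear_boundedP/pinfty_ex_gt0[C C0 HC] : bounded_near g (nbhs 0).
    by apply: continuous_linear_bounded; exact: fc.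
  by exists C => //; exact: ltW.
- split=> //.
  pose g : {linear V -> R^o} := HB.pack f (GRing.isLinear.Build _ _ _ _ f fl).
  apply: (@bounded_linear_continuous _ _ _ g); apply/linear_boundedP.
  near=> r => x; apply: le_trans (fC x) _; apply: ler_wpM2r; first exact: normr_ge0.
  by near: r; apply: nbhs_pinfty_ge; exact: num_real.
Unshelve. all: by end_near. Qed.

Lemma bounded_functional_submod : submod_closed bounded_functional.
Proof.
split=> [|a f g /bounded_functionalP[fl [A A0 fA]] /bounded_functionalP[gl [B B0 gB]]];
    apply/bounded_functionalP; split.
- by move=> k x y /=; rewrite scaler0 addr0.
- by exists 0 => // x; rewrite normr0 mul0r.
- move=> k x y; rewrite !fctE fl gl !scalerDr !scalerA (mulrC a k).
  by rewrite addrACA.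
- exists (`|a| * A + B) => [|x]; first by rewrite addr_ge0// mulr_ge0.
  rewrite mulrDl (le_trans (ler_normD _ _))// lerD// normrM -mulrA.
  by rewrite ler_wpM2l.
Qed.

HB.instance Definition _ :=
  GRing.isSubmodClosed.Build R (V -> R^o) bounded_functional bounded_functional_submod.

Definition dual : Type := {f : V -> R^o | f \in bounded_functional}.

HB.instance Definition _ := SubType.copy dual {f | f \in bounded_functional}.
HB.instance Definition _ := [Choice of dual by <:].
HB.instance Definition _ := [SubChoice_isSubLmodule of dual by <:].

Definition dual_norm (f : dual) : R := sup [set `|val f x| | x in [set x | `|x| <= 1]].

Lemma dual_linear (f : dual) : linear (val f).
Proof. by have /bounded_functionalP[] := valP f. Qed.

Lemma dualZ (f : dual) a x : val f (a *: x) = a * val f x.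
Proof.
have f0 : val f 0 = 0.
  by have := dual_linear f 1 0 0; rewrite scaler0 addr0 scale1r -[LHS]addr0 => /addrI.
by have := dual_linear f a x 0; rewrite !addr0 f0 addr0.
Qed.

Lemma dual_has_sup (f : dual) : has_sup [set `|val f x| | x in [set x | `|x| <= 1]].
Proof.
split; first by exists `|val f 0|, 0 => //=; rewrite normr0.
have /bounded_functionalP[_ [C C0 fC]] := valP f.
exists C => _ [x /= x1 <-]; apply: le_trans (fC x) _.
by rewrite ler_piMr.
Qed.

Lemma dual_normP (f : dual) e : 0 <= e ->
  dual_norm f <= e <-> forall x, `|val f x| <= e * `|x|.
Proof.
move=> e0; split=> [fe x|fe]; last first.
  apply: ge_sup; first exact: (dual_has_sup f).1.
  move=> _ [x /= x1 <-]; apply: le_trans (fe x) _.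
  by rewrite ler_piMr.
have [->|x0] := eqVneq x 0.
  by have := dualZ f 0 0; rewrite scale0r mul0r => ->; rewrite !normr0 mulr0.
have nx0 : 0 < `|x| by rewrite normr_gt0.
have : `|val f (`|x|^-1 *: x)| <= e.
  apply: le_trans fe; apply: ub_le_sup; first exact: (dual_has_sup f).2.
  exists (`|x|^-1 *: x) => //=.
  by rewrite normrZ normfV normr_id mulVf ?gt_eqF.
by rewrite dualZ normrM normfV normr_id ler_pdivrMl// mulrC.
Qed.

Lemma dual_norm_ge0 (f : dual) : 0 <= dual_norm f.
Proof.
apply: le_trans (normr_ge0 (val f 0)) _; apply: ub_le_sup.
  exact: (dual_has_sup f).2.
by exists 0 => //=; rewrite normr0.
Qed.

Lemma dual_le (f : dual) x : `|val f x| <= dual_norm f * `|x|.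
Proof. by move: x; apply: (dual_normP f (dual_norm_ge0 f)).1. Qed.

Lemma dual_normD (f g : dual) : dual_norm (f + g) <= dual_norm f + dual_norm g.
Proof.
apply: (dual_normP _ _).2; first by rewrite addr_ge0 ?dual_norm_ge0.
move=> x; rewrite mulrDl (le_trans (ler_normD _ _))//.
by rewrite lerD ?dual_le.
Qed.

Lemma dual_normZ (a : R) (f : dual) : dual_norm (a *: f) = `|a| * dual_norm f.
Proof.
have le (b : R) (z : dual) : dual_norm (b *: z) <= `|b| * dual_norm z.
  apply: (dual_normP _ _).2; first by rewrite mulr_ge0 ?dual_norm_ge0.
  by move=> x; rewrite normrM -mulrA ler_wpM2l ?dual_le.
apply/eqP; rewrite eq_le le /=.
have [->|a0] := eqVneq a 0; first by rewrite normr0 mul0r dual_norm_ge0.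
rewrite -ler_pdivlMl ?normr_gt0// -normfV.
by rewrite -{1}[f]scale1r -(mulVf a0) -scalerA le.
Qed.

Lemma dual_norm_eq0 (f : dual) : dual_norm f = 0 -> f = 0.
Proof.
move=> f0; apply/val_inj/funext => x; apply/eqP.
by have := dual_le f x; rewrite f0 mul0r normr_le0.
Qed.

HB.instance Definition _ :=
  Lmodule_isNormed.Build R dual dual_normD dual_normZ dual_norm_eq0.

Lemma dual_complete (F : set_system dual) : ProperFilter F -> cauchy F -> cvg F.
Proof.
apply: (@pointwise_complete R dual V (fun f x => val f x)
  (fun g e => linear (g : V -> R^o) /\ forall x, `|g x| <= e * `|x|)).
- exact: val_inj.
- by [].
- move=> x; exists (`|x| + 1) => [|f]; first by rewrite ltr_wpDl.
  rewrite mulrC; apply: le_trans (dual_le f x) _.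
  by rewrite ler_wpM2l ?lerDl// dual_norm_ge0.
- move=> f e e0 fe; split; first exact: dual_linear.
  exact: (dual_normP f e0).1.
- move=> g e e0 [gl ge]; have gP : g \in bounded_functional.
    by apply/bounded_functionalP; split=> //; exists e.
  by exists (exist _ g gP : dual) => //; apply: (dual_normP _ _).2.
- move=> {}F h g e FF e0 hg hF; split=> [k x y|x].
    apply: (cvg_unique (@Rhausdorff R) (hg _)).
    have : k *: (h f x : R^o) + h f y @[f --> F] --> k *: (g x : R^o) + g y.
      by apply: cvgD => //; apply: cvgM => //; exact: cvg_cst.
    apply: cvg_trans; apply: near_eq_cvg.
    by apply: filterS hF => f [fl _]; rewrite fl.
  apply: (@cvgr_to_le _ F FF _ (fun f => `|h f x|)).
    exact: cvg_norm.
  by apply: filterS hF => f [].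
Qed.

HB.instance Definition _ := Uniform_isComplete.Build dual dual_complete.

End dual.

Section closed_span.
Variables (R : realType) (V : completeNormedModType R) (A : set V).

Definition span : set V :=
  [set v | exists2 s : seq (R * V), (forall p, p \in s -> A p.2) &
                                    v = \sum_(p <- s) p.1 *: p.2].

Definition closure_span : {pred V} := mem (closure span).

Lemma span_lin a x y : span x -> span y -> span (a *: x + y).
Proof.
move=> [s sA ->] [t tA ->].
exists ([seq (a * p.1, p.2) | p <- s] ++ t) => [p|].
  by rewrite mem_cat => /orP[/mapP[q qs ->]|]; [exact: (sA q)|exact: tA].
rewrite big_cat big_map /= scaler_sumr; congr (_ + _).
by apply: eq_bigr => p _; rewrite scalerA.
Qed.

Lemma closure_spanP (x : V) :
  reflect (forall e, 0 < e -> exists2 y, span y & `|x - y| < e)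
          (x \in closure_span).
Proof.
apply: (iffP idP) => [|xA]; rewrite inE /=.
- move=> xA e e0; have [y [yA]] := xA _ (nbhsx_ballx x e e0).
  by rewrite -ball_normE /=; exists y.
- move=> B /nbhs_ballP[e e0 xB]; have [y yA xy] := xA _ e0.
  by exists y; split=> //; apply: xB; rewrite -ball_normE.
Qed.

Lemma closure_span_submod : submod_closed closure_span.
Proof.
split=> [|a x y /closure_spanP xA /closure_spanP yA]; apply/closure_spanP => e e0.
  by exists 0; [exists [::]; rewrite ?big_nil|rewrite subrr normr0].
have a0 : 0 < `|a| + 1 by rewrite ltr_wpDl.
have d0 : 0 < e / 2 by rewrite divr_gt0.
have [x' x'A xx'] := xA _ (divr_gt0 d0 a0).
have [y' y'A yy'] := yA _ d0.
exists (a *: x' + y'); first exact: span_lin.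
rewrite opprD addrACA -scalerBr (le_lt_trans (ler_normD _ _))// normrZ.
rewrite (splitr e) ler_ltD//.
rewrite (@le_trans _ _ ((`|a| + 1) * `|x - x'|))// ?ler_wpM2r ?lerDl//.
by rewrite mulrC -ler_pdivlMr// ltW.
Qed.

HB.instance Definition _ :=
  GRing.isSubmodClosed.Build R V closure_span closure_span_submod.

Definition closed_span : Type := {x : V | x \in closure_span}.

HB.instance Definition _ := SubType.copy closed_span {x | x \in closure_span}.
HB.instance Definition _ := [Choice of closed_span by <:].
HB.instance Definition _ := [SubChoice_isSubLmodule of closed_span by <:].

Definition closed_span_norm (x : closed_span) : R := `|val x|.

Lemma closed_span_normD (x y : closed_span) :
  closed_span_norm (x + y) <= closed_span_norm x + closed_span_norm y.
Proof. exact: ler_normD. Qed.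

Lemma closed_span_normZ (a : R) (x : closed_span) :
  closed_span_norm (a *: x) = `|a| * closed_span_norm x.
Proof. exact: normrZ. Qed.

Lemma closed_span_norm_eq0 (x : closed_span) : closed_span_norm x = 0 -> x = 0.
Proof. by move=> /normr0_eq0 x0; exact: val_inj. Qed.

HB.instance Definition _ := Lmodule_isNormed.Build R closed_span
  closed_span_normD closed_span_normZ closed_span_norm_eq0.

Lemma closed_span_complete (F : set_system closed_span) :
  ProperFilter F -> cauchy F -> cvg F.
Proof.
move=> FF /cauchy_ballP Fc.
have /cvg_ex[/= l Fl] : cvg (val x @[x --> F]).
  apply/cauchy_cvgP/cauchy_ballP => e e0; rewrite near_map2.
  by apply: filterS (Fc _ e0) => -[x y]; rewrite -!ball_normE.
have lA : l \in closure_span.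
  rewrite inE; apply: (closed_cvg _ (@closed_closure _ span)) Fl => //.
  by apply: nearW => x; have := valP x; rewrite inE.
apply/cvg_ex; exists (exist _ l lA : closed_span); apply/cvgrPdist_lt => e e0.
by have /cvgrPdist_lt/(_ _ e0) := Fl.
Qed.

HB.instance Definition _ := Uniform_isComplete.Build closed_span closed_span_complete.

End closed_span.

Section lipschitz_free.
Variables (R : realType) (M : metricType R) (o : M).

Definition lipschitz0 : {pred M -> R^o} :=
  mem [set h : M -> R^o |
       h o = 0 /\ exists k, forall u v, `|h u - h v| <= k * mdist u v].

Lemma lipschitz0_submod : submod_closed lipschitz0.
Proof.
split=> [|a f g]; rewrite !inE /=.
  by split=> //; exists 0 => u v; rewrite subrr normr0 mul0r.
move=> [f0 [k fk]] [g0 [l gl]]; split.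
  by rewrite !fctE f0 g0 scaler0 addr0.
exists (`|a| * k + l) => u v; rewrite !fctE opprD addrACA -scalerBr.
rewrite (le_trans (ler_normD _ _))// mulrDl lerD// normrZ -mulrA.
by rewrite ler_wpM2l.
Qed.

HB.instance Definition _ :=
  GRing.isSubmodClosed.Build R (M -> R^o) lipschitz0 lipschitz0_submod.

Definition Lip0 : Type := {h : M -> R^o | h \in lipschitz0}.

HB.instance Definition _ := SubType.copy Lip0 {h | h \in lipschitz0}.
HB.instance Definition _ := [Choice of Lip0 by <:].
HB.instance Definition _ := [SubChoice_isSubLmodule of Lip0 by <:].

Definition Lip0_quotients (h : Lip0) : set R :=
  [set r | exists u v, u != v /\ r = `|val h u - val h v| / mdist u v].

(* [sup set0 = 0], which is the right value when [M] is a singleton. *)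
Definition Lip0_norm (h : Lip0) : R := sup (Lip0_quotients h).

Lemma Lip0_has_ubound (h : Lip0) : has_ubound (Lip0_quotients h).
Proof.
have := valP h; rewrite inE /= => -[_ [k hk]].
exists k => _ [u [v [uv ->]]].
by rewrite ler_pdivrMr ?mdist_gt0//; exact: hk.
Qed.

Lemma Lip0_normP (h : Lip0) e : 0 <= e ->
  Lip0_norm h <= e <-> forall u v, `|val h u - val h v| <= e * mdist u v.
Proof.
move=> e0; split=> [he u v|he].
  have [->|uv] := eqVneq u v; first by rewrite subrr normr0 mulr_ge0 ?mdist_ge0.
  rewrite -ler_pdivrMr ?mdist_gt0//; apply: le_trans he.
  by apply: (ub_le_sup (Lip0_has_ubound h)); exists u, v.
have [h0|/set0P hn0] := eqVneq (Lip0_quotients h) set0.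
  by rewrite /Lip0_norm h0 sup0.
apply: ge_sup => // _ [u [v [uv ->]]].
by rewrite ler_pdivrMr ?mdist_gt0.
Qed.

Lemma Lip0_norm_ge0 (h : Lip0) : 0 <= Lip0_norm h.
Proof.
have [h0|/set0P[r hr]] := eqVneq (Lip0_quotients h) set0.
  by rewrite /Lip0_norm h0 sup0.
apply: le_trans (ub_le_sup (Lip0_has_ubound h) hr).
by case: hr => u [v [_ ->]]; rewrite divr_ge0 ?mdist_ge0.
Qed.

Lemma Lip0_le (h : Lip0) u v : `|val h u - val h v| <= Lip0_norm h * mdist u v.
Proof. by move: u v; apply: (Lip0_normP h (Lip0_norm_ge0 h)).1. Qed.

Lemma Lip0_normD (f g : Lip0) : Lip0_norm (f + g) <= Lip0_norm f + Lip0_norm g.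
Proof.
apply: (Lip0_normP _ _).2; first by rewrite addr_ge0 ?Lip0_norm_ge0.
move=> u v; rewrite /= !fctE opprD addrACA mulrDl.
by rewrite (le_trans (ler_normD _ _))// lerD ?Lip0_le.
Qed.

Lemma Lip0_normZ (a : R) (f : Lip0) : Lip0_norm (a *: f) = `|a| * Lip0_norm f.
Proof.
have le (b : R) (z : Lip0) : Lip0_norm (b *: z) <= `|b| * Lip0_norm z.
  apply: (Lip0_normP _ _).2; first by rewrite mulr_ge0 ?Lip0_norm_ge0.
  move=> u v; rewrite /= !fctE -scalerBr normrZ -mulrA ler_wpM2l//.
  exact: Lip0_le.
apply/eqP; rewrite eq_le le /=.
have [->|a0] := eqVneq a 0; first by rewrite normr0 mul0r Lip0_norm_ge0.
rewrite -ler_pdivlMl ?normr_gt0// -normfV.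
by rewrite -{1}[f]scale1r -(mulVf a0) -scalerA le.
Qed.

Lemma Lip0_base (h : Lip0) : val h o = 0.
Proof. by have := valP h; rewrite inE => -[]. Qed.

Lemma Lip0_norm_eq0 (f : Lip0) : Lip0_norm f = 0 -> f = 0.
Proof.
move=> f0; apply/val_inj/funext => u; apply/eqP.
by have := Lip0_le f u o; rewrite f0 mul0r normr_le0 Lip0_base subr0.
Qed.

HB.instance Definition _ :=
  Lmodule_isNormed.Build R Lip0 Lip0_normD Lip0_normZ Lip0_norm_eq0.

Definition evaluation (u : M) (h : Lip0) : R^o := val h u.

Lemma evaluation_bounded u : evaluation u \in @bounded_functional R Lip0.
Proof.
apply/bounded_functionalP; split=> [a f g //|].
exists (mdist u o) => [|h]; first exact: mdist_ge0.
by rewrite mulrC; have := Lip0_le h u o; rewrite Lip0_base subr0.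
Qed.

Definition delta (u : M) : dual Lip0 := Sub (evaluation u) (evaluation_bounded u).

Definition lipschitz_free : Type := closed_span (range delta).

HB.instance Definition _ :=
  CompleteNormedModule.copy lipschitz_free (closed_span (range delta)).

End lipschitz_free.

Definition is_metric (R : realType) (M : Type) (d : M -> M -> R) : Prop :=
  [/\ forall x, d x x = 0, forall x y, d x y = 0 -> x = y,
      forall x y, d x y = d y x & forall y x z, d x z <= d x y + d y z].

(* [M] with its metric replaced by [d]. *)
Definition remetrized (R : realType) (M : choiceType) (d : M -> M -> R)
  (dM : is_metric d) : Type := M.

Section remetrized.
Variables (R : realType) (M : choiceType) (d : M -> M -> R) (dM : is_metric d).

Let dxx x : d x x = 0. Proof. by have [] := dM. Qed.
Let d_eq0 x y : d x y = 0 -> x = y. Proof. by have [_ + _ _] := dM; exact. Qed.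
Let dC x y : d x y = d y x. Proof. by have [] := dM. Qed.
Let dD y x z : d x z <= d x y + d y z. Proof. by have [] := dM. Qed.

HB.instance Definition _ := Choice.copy (remetrized dM) M.
HB.instance Definition _ := isMetric.Build R (remetrized dM) dxx d_eq0 dC dD.

End remetrized.

(* [F_omega(V)], for the metric of the norm of [V] and the base point [0]. *)
Definition lipschitz_free_gauge (R : realType) (V : normedModType R)
    (omega : R -> R) (dV : is_metric (fun x y : V => omega `|x - y|)) :
    completeNormedModType R :=
  @lipschitz_free R (remetrized dV) (0 : V).

Definition max_id_sqrt (R : realType) (t : R) : R := Num.max t (Num.sqrt t).

Lemma max_id_sqrt_metric (R : realType) (V : normedModType R) :
  is_metric (fun x y : V => max_id_sqrt `|x - y|).
Proof.
have sD (a b : R) : 0 <= a -> 0 <= b ->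
    Num.sqrt (a + b) <= Num.sqrt a + Num.sqrt b.
  move=> a0 b0; rewrite -(ler_pXn2r (_ : 0 < 2)%N) ?nnegrE ?addr_ge0 ?sqrtr_ge0//.
  rewrite sqr_sqrtr ?addr_ge0// sqrrD !sqr_sqrtr//.
  by have := mulr_ge0 (sqrtr_ge0 a) (sqrtr_ge0 b); lra.
split=> [x|x y|x y|y x z]; rewrite /max_id_sqrt.
- by rewrite subrr normr0 sqrtr0 maxxx.
- move=> m0; apply/eqP; rewrite -subr_eq0 -normr_le0 -[leRHS]m0.
  by rewrite le_max lexx.
- by rewrite distrC.
- rewrite ge_max; apply/andP; split.
    apply: le_trans (ler_distD y x z) _.
    by apply: lerD; rewrite le_max lexx.
  have [x0 z0] := (normr_ge0 (x - y), normr_ge0 (y - z)).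
  apply: le_trans (_ : Num.sqrt (`|x - y| + `|y - z|) <= _).
    by apply: ler_wsqrtr; exact: ler_distD.
  by apply: le_trans (sD _ _ x0 z0) _; apply: lerD; rewrite le_max lexx orbT.
Qed.

Definition F_omega_ell2 (R : realType) : completeNormedModType R :=
  lipschitz_free_gauge (@max_id_sqrt_metric R (ell2 R)).

(* [g] is the inverse of [f]: only its values on [range f] matter. *)
Definition almost_isometric_injections (R : realType)
    (X Y : completeNormedModType R) : Prop :=
  forall eps : R, 0 < eps -> exists f : X -> Y,
    [/\ injective f,
        forall x y, 0 <= `|f x - f y| - `|x - y| <= eps,
        unif_continuous f &
        exists2 g : Y -> X, cancel f g & 1.-lipschitz_(range f) g].

Definition isometric_embedding (R : realType) (X Y : normedModType R)
  (g : X -> Y) : Prop := forall x y, `|g x - g y| = `|x - y|.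

(* Main.v *)
Require Import Defs.
From mathcomp Require Import all_boot all_order all_algebra.
From mathcomp Require Import all_classical all_reals all_analysis.
From mathcomp Require Import ring lra.

(** The almost isometries are rescaled Dirac maps. Since Dirac masses of a free
space are at the same distance as the points that carry them, the map
[x |-> eps * delta(x / eps)] turns a distance [t] into
[eps * omega(t / eps) = max(t, sqrt(eps t))], which exceeds [t] by at most
[eps / 4].

For the absence of isometries, let [g : l2 -> F] be isometric, [F] being the
free space for the gauge [omega(t) = max(t, sqrt t)].

Linearization. Take the Lipschitz function [h] that almost norms
[g(t e_n) - g(- t e_n)] for a huge [t]. The sphere of [l2] of radius [t] is
nearly flat on bounded sets, so [h o g] is forced to be the coordinate [y_n]
there, up to a constant and a small error ([coordinate_functional]). The mean
of the translates of [g] over the Hilbert cube with sides [2^-n e_n] is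
differentiable along the [e_n]. Let [mu_n] be its slopes at the origin; as the
mean is Lipschitz with constant 1,
[`|sum_(n in s) mu_n| <= `|sum_(n in s) e_n|]. The cube average is a limit of
averages over finite dyadic grids, so the [mu_n] belong to [F] ([slope_sum]),
and the [h] above are almost biorthogonal to them ([slope_affine]). Thus [F]
contains a seminormalized sequence whose sums of [k] terms have norm at most
[sqrt k].

Gliding humps. Such a sequence cannot exist in [F]: one constructs uniformly
Lipschitz functions that pair with [k] of the [mu_n] to more than [c k]
([gliding_hump]). A function is added to those already chosen, and the
Lipschitz constant must not grow. By extraction there are always functions [p]
that are small on any given finite set and pair well with some late [mu_n]
([nearly_equal_pair]). Two cases arise.
 - Functions of small size relative to [1 + d(u, 0)] are nearly invisible to
   late [mu_n]. Then [p] can be cut down to bumps around finitely many points,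
   whose supports avoid the supports of the earlier bumps; a supremum of
   disjoint nonnegative bumps keeps their Lipschitz constant ([insensitive_case]).
 - There are late [mu_n] seen by functions [p] of arbitrarily small relative
   size. Here the square root in [omega] enters: on a finite set of points, [p]
   agrees with a function that is also Lipschitz for the norm. At small
   scales [omega] dominates any multiple of the norm, so the earlier functions
   are flat; at the other scales the new one is negligible. Hence the sum has
   hardly a larger Lipschitz constant than its terms
   ([sensitive_case]). *)

Set Implicit Arguments.
Unset Strict Implicit.
Unset Printing Implicit Defensive.

Import Order.TTheory GRing.Theory Num.Theory.
Import numFieldNormedType.Exports.

Local Open Scope classical_set_scope.
Local Open Scope ring_scope.

(** * The pairing between Lipschitz functions and the free space *)

Section dual_operations.
Variables (R : realType) (V : normedModType R).
Implicit Types f g : dual V.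

Lemma dual_addE f g x : val (f + g) x = val f x + val g x. Proof. by []. Qed.

Lemma dual_oppE f x : val (- f) x = - val f x. Proof. by []. Qed.

Lemma dual_scaleE f a x : val (a *: f) x = a * val f x. Proof. by []. Qed.

Lemma dual_zeroE x : val (0 : dual V) x = 0. Proof. by []. Qed.

End dual_operations.

Section closed_span_operations.
Variables (R : realType) (V : completeNormedModType R) (A : set V).
Implicit Types x y : closed_span A.

Lemma closed_span_addE x y : val (x + y) = val x + val y. Proof. by []. Qed.

Lemma closed_span_oppE x : val (- x) = - val x. Proof. by []. Qed.

Lemma closed_span_scaleE x a : val (a *: x) = a *: val x. Proof. by []. Qed.

Lemma closed_span_zeroE : val (0 : closed_span A) = 0. Proof. by []. Qed.

Lemma closed_span_sumE (I : Type) (r : seq I) (x : I -> closed_span A) :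
  val (\sum_(i <- r) x i) = \sum_(i <- r) val (x i).
Proof.
elim: r => [|i r IH]; rewrite ?big_nil ?closed_span_zeroE//.
by rewrite !big_cons closed_span_addE IH.
Qed.

End closed_span_operations.

(** A notation, so that the normed structure of closed spans is found by
unification on the underlying type. *)
Notation free_space o := (closed_span (range (@delta _ _ o))).

Section pairing.
Variables (R : realType) (M : metricType R) (o : M).
Implicit Types (h k : Lip0 o) (mu nu : free_space o).

Definition pairing h mu : R := val (val mu) h.

Lemma pairingDr h mu nu : pairing h (mu + nu) = pairing h mu + pairing h nu.
Proof. by rewrite /pairing closed_span_addE dual_addE. Qed.

Lemma pairingNr h mu : pairing h (- mu) = - pairing h mu.
Proof. by rewrite /pairing closed_span_oppE dual_oppE. Qed.

Lemma pairingBr h mu nu : pairing h (mu - nu) = pairing h mu - pairing h nu.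
Proof. by rewrite pairingDr pairingNr. Qed.

Lemma pairingZr h a mu : pairing h (a *: mu) = a * pairing h mu.
Proof. by rewrite /pairing closed_span_scaleE dual_scaleE. Qed.

Lemma pairing0r h : pairing h 0 = 0.
Proof. by rewrite /pairing closed_span_zeroE dual_zeroE. Qed.

Lemma pairing_sumr h (I : Type) (r : seq I) (mu : I -> free_space o) :
  pairing h (\sum_(i <- r) mu i) = \sum_(i <- r) pairing h (mu i).
Proof.
by elim: r => [|i r IH]; rewrite ?big_nil ?pairing0r// !big_cons pairingDr IH.
Qed.

Lemma pairing_lin_l a h k mu :
  pairing (a *: h + k) mu = a * pairing h mu + pairing k mu.
Proof. exact: dual_linear. Qed.

Lemma pairing0l mu : pairing 0 mu = 0.
Proof.
have := pairing_lin_l 1 0 0 mu.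
by rewrite scaler0 addr0 mul1r -[LHS]addr0 => /addrI.
Qed.

Lemma pairingDl h k mu : pairing (h + k) mu = pairing h mu + pairing k mu.
Proof. by have := pairing_lin_l 1 h k mu; rewrite scale1r mul1r. Qed.

Lemma pairingZl a h mu : pairing (a *: h) mu = a * pairing h mu.
Proof. by have := pairing_lin_l a h 0 mu; rewrite pairing0l !addr0. Qed.

Lemma pairingNl h mu : pairing (- h) mu = - pairing h mu.
Proof. by rewrite -scaleN1r pairingZl mulN1r. Qed.

Lemma pairingBl h k mu : pairing (h - k) mu = pairing h mu - pairing k mu.
Proof. by rewrite pairingDl pairingNl. Qed.

Lemma pairing_le h mu : `|pairing h mu| <= `|h| * `|mu|.
Proof. by rewrite mulrC; exact: dual_le. Qed.

Lemma pairing_norming mu (e : R) : 0 < e ->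
  exists2 h, `|h| <= 1 & `|mu| - e <= pairing h mu.
Proof.
move=> e0.
have [_ [h /= h1 <-]] := sup_adherent e0 (dual_has_sup (val mu)).
move=> /ltW he; have [s|s] := leP 0 (pairing h mu).
  by exists h => //; rewrite -(ger0_norm s).
exists (- h); first by rewrite normrN.
by rewrite pairingNl -(ltr0_norm s).
Qed.

Lemma delta_closure_span u : delta o u \in closure_span (range (@delta R M o)).
Proof.
apply/closure_spanP => e e0; exists (delta o u); last by rewrite subrr normr0.
exists [:: (1, delta o u)]; last by rewrite big_seq1 scale1r.
by move=> p; rewrite inE => /eqP -> /=; exists u.
Qed.

Definition free_delta u : free_space o :=
  exist _ (delta o u) (delta_closure_span u).

Lemma pairing_delta h u : pairing h (free_delta u) = val h u.
Proof. by []. Qed.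

Lemma range_delta_comb (s : seq (R * dual (Lip0 o))) :
  (forall p, p \in s -> range (@delta R M o) p.2) ->
  exists t : seq (R * M),
    \sum_(p <- s) p.1 *: p.2 = \sum_(p <- t) p.1 *: delta o p.2.
Proof.
elim: s => [_|p s IH ps]; first by exists [::]; rewrite !big_nil.
have [|t tE] := IH; first by move=> q qs; apply: ps; rewrite inE qs orbT.
have [u _ uE] := ps p (mem_head _ _).
by exists ((p.1, u) :: t); rewrite !big_cons tE /= uE.
Qed.

Lemma free_delta_dense mu (e : R) : 0 < e ->
  exists s : seq (R * M), `|mu - \sum_(p <- s) p.1 *: free_delta p.2| < e.
Proof.
move=> e0; have /closure_spanP/(_ _ e0)[_ [s sA ->]] := valP mu.
have [t ->] := range_delta_comb sA => mt; exists t.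
apply: le_lt_trans mt; rewrite -[leLHS]/`|val (mu - _)|.
rewrite closed_span_addE closed_span_oppE closed_span_sumE.
by under eq_bigr do rewrite closed_span_scaleE.
Qed.

(** Finitely supported elements are dense, and the estimate is uniform on balls
of Lipschitz functions: two such functions that agree on the support found here
pair with [mu] to almost the same value. *)
Lemma pairing_approx mu (e : R) : 0 < e ->
  exists s : seq (R * M), forall h,
    `|pairing h mu - \sum_(p <- s) p.1 * val h p.2| <= `|h| * e.
Proof.
move=> /(free_delta_dense mu)[s /ltW se]; exists s => h.
have -> : \sum_(p <- s) p.1 * val h p.2 =
    pairing h (\sum_(p <- s) p.1 *: free_delta p.2).
  by rewrite pairing_sumr; apply: eq_bigr => p _; rewrite pairingZr.
by rewrite -pairingBr (le_trans (pairing_le _ _))// ler_wpM2l.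
Qed.

Lemma Lip0_of (h : M -> R) (k : R) : 0 <= k -> h o = 0 ->
  (forall u v, `|h u - h v| <= k * mdist u v) ->
  exists2 H : Lip0 o, val H = h & `|H| <= k.
Proof.
move=> k0 h0 hk; have hP : (h : M -> R^o) \in lipschitz0 o.
  by rewrite inE; split=> //; exists k.
by exists (Sub (h : M -> R^o) hP : Lip0 o) => //; apply: (Lip0_normP _ k0).2.
Qed.

Lemma Lip0_ineq h (k : R) u v : `|h| <= k -> `|val h u - val h v| <= k * mdist u v.
Proof.
by move=> hk; apply: le_trans (Lip0_le h u v) _; rewrite ler_wpM2r// mdist_ge0.
Qed.

(** The lower bound is attained at the distance function to [v]. *)
Lemma norm_free_deltaB u v : `|free_delta u - free_delta v| = mdist u v.
Proof.
apply/eqP; rewrite eq_le; apply/andP; split.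
  apply: (dual_normP _ (mdist_ge0 _ _)).2 => h; rewrite mulrC.
  exact: Lip0_le.
have [|x y|H HE H1] := @Lip0_of (fun x => mdist x v - mdist o v) 1 ler01.
- by rewrite subrr.
- have := metric_triangle x y v; have := metric_triangle y x v.
  by rewrite (metric_sym y x) ler_norml; lra.
have := pairing_le H (free_delta u - free_delta v).
rewrite pairingBr !pairing_delta HE mdistxx sub0r opprK subrK.
move=> /(le_trans (ler_norm _)) /le_trans; apply.
by rewrite ler_piMl.
Qed.

End pairing.

(** * Gliding humps along a sequence with an upper 2-estimate *)

Section gliding_hump.
Variables (R : realType) (M : metricType R) (o : M) (mu : nat -> free_space o).
Hypothesis mu_sum : forall s : seq nat, uniq s ->
  `|\sum_(i <- s) mu i| ^+ 2 <= (size s)%:R.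

(** The pairing is at most [C * sqrt k], which is eventually less than [k * c]. *)
Lemma no_linear_growth (C c : R) : 0 < c ->
  ~ forall k, exists s H, [/\ uniq s, size s = k, `|H| <= C &
      k%:R * c <= pairing H (\sum_(i <- s) mu i)].
Proof.
move=> c0 Hk; pose k := (Num.truncn (C ^+ 2 / c ^+ 2)).+1.
have [s [H [us sk HC kc]]] := Hk k.
have k0 : 0 < k%:R :> R by rewrite ltr0n.
have : C ^+ 2 < k%:R * c ^+ 2.
  by rewrite -ltr_pdivrMr ?exprn_gt0// truncnS_gt.
apply/negP; rewrite -leNgt.
have HS : k%:R * c <= `|H| * `|\sum_(i <- s) mu i|.
  by apply: le_trans kc _; apply: le_trans (ler_norm _) (pairing_le _ _).
have {}HS : (k%:R * c) ^+ 2 <= C ^+ 2 * k%:R.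
  apply: (@le_trans _ _ ((`|H| * `|\sum_(i <- s) mu i|) ^+ 2)).
    by rewrite ler_pXn2r ?nnegrE// mulr_ge0 ?ltW.
  rewrite exprMn ler_pM ?sqr_ge0//.
    by rewrite ler_pXn2r ?nnegrE// (le_trans _ HC).
  by rewrite -sk; exact: mu_sum.
by rewrite -(ler_pM2r k0) (le_trans _ HS)// exprMn expr2 mulrAC.
Qed.

Lemma all_ltn_notin (s : seq nat) m n :
  all (fun i => (i < m)%N) s -> (m <= n)%N -> n \notin s.
Proof. by move=> /allP sm mn; apply/negP => /sm; rewrite ltnNge mn. Qed.

(** The sequence is weakly null: otherwise a fixed [H] would pair to at least [e]
with infinitely many terms, hence linearly in [k] with sums of [k] terms. *)
Lemma pairing_eventually_lt H (e : R) : 0 < e ->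
  exists n0, forall n, (n0 <= n)%N -> pairing H (mu n) < e.
Proof.
move=> e0; apply: contrapT => noN.
have ex n0 : exists2 n, (n0 <= n)%N & e <= pairing H (mu n).
  apply: contrapT => no; apply: noN; exists n0 => n n0n.
  by rewrite ltNge; apply/negP => en; apply: no; exists n.
suff grow k : exists s m, [/\ uniq s, size s = k, all (fun i => (i < m)%N) s &
    k%:R * e <= pairing H (\sum_(i <- s) mu i)].
  apply: (no_linear_growth (C := `|H|) e0) => k.
  by have [s [m [us sk _ ke]]] := grow k; exists s, H.
elim: k => [|k [s [m [us sk sm ke]]]].
  by exists [::], 0%N; split=> //; rewrite big_nil pairing0r mul0r.
have [n mn en] := ex m; exists (n :: s), n.+1; split => /=.
- by rewrite us andbT (all_ltn_notin sm).
- by rewrite sk.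
- rewrite ltnSn /=; apply: sub_all sm => i im.
  by rewrite ltnS ltnW// (leq_trans im).
- by rewrite big_cons pairingDr -natr1 mulrDl mul1r addrC lerD.
Qed.

Lemma pairing_eventually_le H (e : R) : 0 < e ->
  exists n0, forall n, (n0 <= n)%N -> `|pairing H (mu n)| <= e.
Proof.
move=> e0; have [n1 H1] := pairing_eventually_lt H e0.
have [n2 H2] := pairing_eventually_lt (- H) e0.
exists (maxn n1 n2) => n; rewrite geq_max => /andP[/H1 le1 /H2].
by rewrite pairingNl ler_norml => le2; rewrite (ltW le1) lerNl ltW.
Qed.

(** The predicate [P] is the invariant of an inductive construction. Each step
adds to the current function [H] a function [h] that detects a new term
[mu n] and nearly ignores the sum [nu] of the earlier terms; [H] itself nearly
ignores [mu n] once [n] is large. After [k] steps the pairing is at least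
[k * c / 2], while [P] keeps the norm bounded. *)
Lemma gliding_hump (P : Lip0 o -> Prop) (C c : R) : 0 < c ->
  P 0 -> (forall H, P H -> `|H| <= C) ->
  ~ forall H nu e n0, P H -> 0 < e -> exists n h,
      [/\ (n0 <= n)%N, P (H + h), `|pairing h nu| <= e & c <= pairing h (mu n)].
Proof.
move=> c0 P0 PC step.
suff grow k : exists s m H, [/\ uniq s, size s = k, all (fun i => (i < m)%N) s,
    P H & k%:R * (c / 2) <= pairing H (\sum_(i <- s) mu i)].
  apply: (@no_linear_growth C (c / 2)); first by rewrite divr_gt0.
  move=> k; have [s [m [H [us sk _ PH ke]]]] := grow k.
  by exists s, H; split=> //; exact: PC.
elim: k => [|k [s [m [H [us sk sm PH ke]]]]].
  by exists [::], 0%N, 0; split=> //; rewrite big_nil pairing0r mul0r.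
have c4 : 0 < c / 4 by rewrite divr_gt0.
have [n0 Hn0] := pairing_eventually_le H c4.
have [n [h [+ Phh hnu hn]]] :=
  step H (\sum_(i <- s) mu i) (c / 4) (maxn m n0) PH c4.
rewrite geq_max => /andP[mn n0n].
exists (n :: s), n.+1, (H + h); split=> //=.
- by rewrite us andbT (all_ltn_notin sm).
- by rewrite sk.
- rewrite ltnSn /=; apply: sub_all sm => i im.
  by rewrite ltnS ltnW// (leq_trans im).
- have := Hn0 n n0n; rewrite big_cons pairingDr !pairingDl -[k.+1%:R]natr1.
  by move: hnu ke hn; rewrite !ler_norml => /andP[+ _] + + /andP[+ _]; lra.
Qed.

End gliding_hump.

Section nearly_equal_pair.
Variables (R : realType) (M : metricType R) (o : M) (h : nat -> Lip0 o).
Hypothesis h1 : forall n, `|h n| <= 1.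

(** Cluster points are taken one point of [S] at a time, restricting the filter
at each step to the indices that stay close to the cluster value. *)
Lemma nearly_constant_filter (S : seq M) (e : R) : 0 < e ->
  exists F : set_system nat, [/\ ProperFilter F, \oo `<=` F &
    forall s, s \in S -> exists l, \forall n \near F, `|l - val (h n) s| < e].
Proof.
move=> e0; elim: S => [|t S [F [FF sF FS]]].
  by exists \oo; split=> //; exact: eventually_filter.
pose h_t n : R := val (h n) t.
have [l [_ Fl]] : `[- mdist t o, mdist t o]%classic `&` cluster (h_t @ F) !=set0.
  apply: segment_compact; rewrite nbhs_simpl /=; apply: (@filterE _ F) => n /=.
  rewrite in_itv /= -ler_norml.
  by have := Lip0_ineq t o (h1 n); rewrite mul1r Lip0_base subr0.
pose A := [set n | `|l - h_t n| < e].
exists (within A F); split.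
- split; last exact: within_filter.
  (* If the trace of F on A were improper, F would contain the complement of A,
     which misses a ball around the cluster value. *)
  rewrite /within /= => F0; have := Fl (~` ball l e) (ball l e) _ (nbhsx_ballx _ _ e0).
  case=> [|x [] //].
  by apply: filterS F0 => n /= nA; rewrite -ball_normE.
- by move=> B /sF FB; apply: filterS FB => n Bn _.
- move=> s; rewrite inE => /predU1P[->|/FS[k Hk]].
    by exists l; rewrite near_withinE; exact: nearW.
  by exists k; apply: filterS Hk => n Hn _.
Qed.

(** Infinitely many functions of the unit ball cannot be pairwise separated on a
finite set. The difference of the two functions found here is small on [S],
although it may have a large pairing with an element of the free space. *)
Lemma nearly_equal_pair (S : seq M) (e : R) n0 : 0 < e ->
  exists n m, [/\ (n0 <= n)%N, (n < m)%N &
    forall s, s \in S -> `|val (h n) s - val (h m) s| <= e].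
Proof.
move=> e0; have e2 : 0 < e / 2 by rewrite divr_gt0.
have [F [FF sF FS]] := nearly_constant_filter S e2.
have {FS} [l lS] : exists l : M -> R, \forall n \near F,
    forall s, s \in S -> `|l s - val (h n) s| < e / 2.
  elim: S FS => [_|t S IH FS].
    by exists (fun=> 0); apply: nearW => n s; rewrite in_nil.
  have [|l Hl] := IH; first by move=> s sS; apply: FS; rewrite inE sS orbT.
  have [k Hk] := FS t (mem_head _ _).
  exists (fun s => if s == t then k else l s); near=> n => s.
  by rewrite inE; case: eqP => [-> _|_ /= sS]; [near: n|move: s sS; near: n].
have big m : \forall n \near F, (m <= n)%N by apply: sF; exact: nbhs_infty_ge.
have [n [nS n0n]] := filter_ex (filterI lS (big n0)).
have [m [mS nm]] := filter_ex (filterI lS (big n.+1)).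
exists n, m; split=> // s sS; have := nS _ sS; have := mS _ sS.
rewrite !ltr_norml ler_norml; lra.
Unshelve. all: by end_near. Qed.

End nearly_equal_pair.

(** * Lipschitz bounds for maxima and minima *)

Section max_min.
Variable R : realDomainType.
Implicit Types a b c : R.

Lemma maxBmax_le a a' b b' c :
  a - a' <= c -> b - b' <= c -> Num.max a b - Num.max a' b' <= c.
Proof.
move=> aa bb; rewrite lerBlDr ge_max -!lerBlDr; apply/andP; split.
  by apply: le_trans aa; rewrite lerB// le_max lexx.
by apply: le_trans bb; rewrite lerB// le_max lexx orbT.
Qed.

Lemma minBmin_le a a' b b' c :
  a - a' <= c -> b - b' <= c -> Num.min a b - Num.min a' b' <= c.
Proof.
move=> aa bb; rewrite lerBlDl -lerBlDr le_min !lerBlDr; apply/andP; split.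
  by apply: le_trans (_ : a <= _); rewrite ?ge_min ?lexx// -lerBlDl.
by apply: le_trans (_ : b <= _); rewrite ?ge_min ?lexx ?orbT// -lerBlDl.
Qed.

Lemma max0_subN a : Num.max a 0 - Num.max (- a) 0 = a.
Proof.
case: (leP a 0) => a0; first by rewrite max_l ?oppr_ge0// sub0r opprK.
by rewrite max_r ?oppr_le0 ?subr0// ltW.
Qed.

Lemma distr_leP a b c : `|a - b| <= c <-> a - b <= c /\ b - a <= c.
Proof.
by rewrite ler_norml lerNl opprB; split=> [/andP[]//|[-> ->//]].
Qed.

End max_min.

(** * Sequences that do not see functions of small relative size *)

Section bump.
Variables (R : realType) (M : metricType R) (q : M -> R) (K : R).
Hypotheses (q0 : forall u, 0 <= q u) (qK : forall u v, q u - q v <= K * mdist u v).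

(** The function is the supremum of the cones [q s - K * d(u, s)] over [s] in [S],
cut off at zero. A steep cone is positive only close to its vertex. *)
Lemma bump (S : seq M) : exists f : M -> R,
  [/\ forall u, 0 <= f u <= q u, forall u v, f u - f v <= K * mdist u v,
      {in S, f =1 q} &
      forall u, f u != 0 -> exists2 s, s \in S & K * mdist u s < q s].
Proof.
have Kd (u v : M) : 0 <= K * mdist u v.
  by have := qK u v; have := qK v u; rewrite (metric_sym v u); lra.
elim: S => [|t S [f [f0q fK fS fsupp]]].
  by exists (fun=> 0); split=> [u|u v|//|u]; rewrite ?lexx ?q0 ?subrr ?eqxx.
exists (fun u => Num.max (f u) (q t - K * mdist u t)); split.
- move=> u; have /andP[fu0 fuq] := f0q u.
  by rewrite le_max fu0 /= ge_max fuq /= lerBlDl -lerBlDr metric_sym qK.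
- move=> u v; rewrite lerBlDl ge_max; apply/andP; split.
    by rewrite -lerBlDl (le_trans _ (fK u v))// lerB// le_max lexx.
  apply: (@le_trans _ _ (q t - K * mdist v t + K * mdist u v)); last first.
    by rewrite lerD2r le_max lexx orbT.
  have K0 : 0 <= K * (mdist v u + mdist u t - mdist v t).
    have [uv|uv] := eqVneq u v; first by rewrite uv mdistxx add0r subrr mulr0.
    rewrite mulr_ge0 ?subr_ge0 ?metric_triangle//.
    by have := Kd u v; rewrite pmulr_lge0// mdist_gt0.
  by move: K0; rewrite (metric_sym v u); nra.
- move=> s; rewrite inE => /predU1P[->|sS].
    by rewrite mdistxx mulr0 subr0; apply/max_idPr; case/andP: (f0q t).
  rewrite fS//; apply/max_idPl.
  by rewrite lerBlDl -lerBlDr metric_sym qK.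
- move=> u; have [fu|fu] := eqVneq (f u) 0; last first.
    by have [s sS us] := fsupp u fu => _; exists s; rewrite // inE sS orbT.
  rewrite fu; case: ltP => [|_]; last by rewrite eqxx.
  by rewrite subr_gt0 => ut _; exists t; rewrite ?mem_head.
Qed.

End bump.

Section insensitive_case.
Variables (R : realType) (M : metricType R) (o : M) (mu : nat -> free_space o).
Hypothesis mu_sum : forall s : seq nat, uniq s ->
  `|\sum_(i <- s) mu i| ^+ 2 <= (size s)%:R.
Hypothesis mu_small : forall (S : seq M) (e : R) n0, 0 < e ->
  exists n (p : Lip0 o), [/\ (n0 <= n)%N, `|p| <= 2, forall s, s \in S -> `|val p s| <= e &
    1 / 2 <= pairing p (mu n)].

Variables (theta : R) (n1 : nat).
Hypotheses (theta0 : 0 < theta) (theta1 : theta <= 1).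
Hypothesis mu_insensitive : forall n (p : Lip0 o), (n1 <= n)%N -> `|p| <= 2 ->
  (forall u, `|val p u| <= theta * (1 + mdist u o)) ->
  `|pairing p (mu n)| <= 1 / 16.

Variable K : R.
(* A cone of slope K with vertex s and height at most 4 * d(s, o) is positive
   only at points u with d(u, s) at most theta / 4 * (1 + d(u, o)). *)
Hypothesis Ktheta : K * theta = 32.

Let K32 : 32 <= K.
Proof. by rewrite -(ler_pM2r theta0) Ktheta ler_piMr. Qed.

(** Within such a distance, a function of Lipschitz constant 2 that is at most
[theta / 2] on [S] stays below [theta * (1 + d(u, o))]. *)
Definition concentrated (f : M -> R) (S : seq M) := forall u, f u != 0 ->
  exists2 s, s \in S & mdist u s <= theta / 4 * (1 + mdist u o).

(** The part of [p] below [theta * (1 + d(u, o))] is nearly invisible to [mu n],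
and the part above it vanishes on the support of [h] and on [T]. That part is
replaced by the bump around the finite support of an approximation of [mu n],
which lies below it and agrees with it on this support. *)
Lemma detached_bump n (p : Lip0 o) (h : M -> R) (S T : seq M) :
  (n1 <= n)%N -> `|p| <= 2 -> (forall u, 0 <= val p u) ->
  (forall s, s \in S ++ T -> val p s <= theta / 2) -> concentrated h S ->
  exists f : Lip0 o, [/\ `|f| <= K, forall u, 0 <= val f u,
    forall u, val f u != 0 -> h u = 0, forall s, s \in T -> val f s = 0 &
    (exists S', concentrated (val f) S') /\
    `|pairing f (mu n) - pairing p (mu n)| <= 1 / 8].
Proof.
move=> n1n p2 p0 pST hS.
have [t0 t1 k32] := And3 theta0 theta1 K32.
have pL u v : val p u - val p v <= 2 * mdist u v.
  exact: le_trans (ler_norm _) (Lip0_ineq u v p2).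
pose w u := theta * (1 + mdist u o).
have wL u v : w u - w v <= 2 * mdist u v.
  rewrite /w -mulrBr opprD addrACA subrr add0r.
  apply: (@le_trans _ _ (theta * mdist u v)); last first.
    by rewrite ler_wpM2r ?mdist_ge0//; lra.
  by rewrite ler_wpM2l ?(ltW theta0)// lerBlDr metric_triangle.
have w0 (u : M) : 0 <= w u by rewrite mulr_ge0 ?addr_ge0 ?mdist_ge0// ltW.
have [|||m mE m2] := @Lip0_of _ _ o (fun u => Num.min (val p u) (w u)) 2 => //.
- by rewrite Lip0_base; apply/min_idPl.
- move=> u v; apply/distr_leP.
  by split; apply: minBmin_le => //; rewrite (metric_sym u v).
have m16 : `|pairing m (mu n)| <= 1 / 16.
  apply: mu_insensitive => // u; rewrite mE ger0_norm ?ge_min ?lexx ?orbT//.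
  by rewrite le_min p0 w0.
pose q : Lip0 o := p - m.
have q4 : `|q| <= 4 by rewrite (le_trans (ler_normB _ _))//; lra.
have qE u : val q u = val p u - Num.min (val p u) (w u).
  by rewrite -[X in _ - X]/((fun u => Num.min (val p u) (w u)) u) -mE.
have q0 u : 0 <= val q u by rewrite qE subr_ge0 ge_min lexx.
have qL u v : val q u - val q v <= 4 * mdist u v.
  exact: le_trans (ler_norm _) (Lip0_ineq u v q4).
have qK u v : val q u - val q v <= K * mdist u v.
  by rewrite (le_trans (qL _ _))// ler_wpM2r ?mdist_ge0// (le_trans _ K32)//; lra.
have qeq0 u : val p u <= w u -> val q u = 0.
  by move=> pw; rewrite qE; move/min_idPl : pw => ->; rewrite subrr.
have K4 : 0 < K + 4 by lra.
have [t tE] := pairing_approx (mu n) (divr_gt0 ltr01 (mulr_gt0 (ltr0n R 16) K4)).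
have [f [f0q fK ft fsupp]] := bump q0 qK [seq x.2 | x <- t].
have fq0 u : val q u = 0 -> f u = 0.
  by move=> qu; have := f0q u; rewrite qu => /le_anti.
have [|||F FE FK] := @Lip0_of _ _ o f K.
- lra.
- by apply: fq0; exact: Lip0_base.
- by move=> u v; apply/distr_leP; split=> //; rewrite metric_sym.
exists F; rewrite FE; split=> //.
- by move=> u; case/andP: (f0q u).
- move=> u; apply: contra_neqP => /eqP /hS[s sS us]; apply: fq0; apply: qeq0.
  have := pST s; rewrite mem_cat sS => /(_ isT) ps.
  have := mulr_ge0 (ltW theta0) (mdist_ge0 u o).
  by have := pL u s; rewrite /w; lra.
- move=> s sT; apply: fq0; apply: qeq0.
  have := pST s; rewrite mem_cat sT orbT => /(_ isT) /le_trans; apply.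
  by have := mulr_ge0 (ltW theta0) (mdist_ge0 s o); rewrite /w; lra.
split.
  exists [seq x.2 | x <- t] => u /fsupp[s sS us]; exists s => //.
  have := qL s o; rewrite Lip0_base subr0 => qs.
  have so : mdist s o <= mdist u s + mdist u o.
    by rewrite (metric_sym u s) metric_triangle.
  have us' : K * mdist u s <= 4 * mdist s o by rewrite (le_trans (ltW us)).
  have us0 := mdist_ge0 u s; have uo0 := mdist_ge0 u o.
  have : theta * (K * mdist u s) <= theta * (4 * (mdist u s + mdist u o)).
    by rewrite ler_wpM2l ?(ltW theta0)//; lra.
  have : theta * mdist u s <= mdist u s by rewrite ler_piMl.
  have := mulr_ge0 (ltW theta0) uo0.
  by rewrite mulrA (mulrC theta K) Ktheta; lra.
have -> : pairing F (mu n) - pairing p (mu n) =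
    pairing F (mu n) - pairing q (mu n) - pairing m (mu n).
    by rewrite /q pairingBl; lra.
  have := tE F; have := tE q.
  have -> : \sum_(x <- t) x.1 * val F x.2 = \sum_(x <- t) x.1 * val q x.2.
    by apply: eq_big_seq => x xt; rewrite FE ft// map_f.
  set s := \sum_(x <- t) _; set d := 1 / (_ * _).
  have dK : (K + 4) * d = 1 / 16 by rewrite /d; field; rewrite gt_eqF.
  have d0 : 0 <= d by rewrite divr_ge0// mulr_ge0// ltW.
  have Fd : `|F| * d <= K * d by rewrite ler_wpM2r.
  have qd : `|q| * d <= 4 * d by rewrite ler_wpM2r.
  move=> /ler_normlP[? ?] /ler_normlP[? ?]; apply/ler_normlP.
  by move/ler_normlP: m16 => [? ?]; split; lra.
Qed.

(** The invariant asks that the positive and the negative part be separately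
[K]-Lipschitz and that the support be concentrated near a finite set. Adding a
bump of either sign with disjoint support replaces one of the two parts by the
maximum of this part and the bump, which preserves [K]. *)
Lemma insensitive_case : False.
Proof.
have [t0 t1 k32] := And3 theta0 theta1 K32.
pose P (H : Lip0 o) := [/\
  forall u v, Num.max (val H u) 0 - Num.max (val H v) 0 <= K * mdist u v,
  forall u v, Num.max (- val H u) 0 - Num.max (- val H v) 0 <= K * mdist u v &
  exists S, concentrated (val H) S].
have K0 : 0 <= K by lra.
have Kd (u v : M) : 0 <= K * mdist u v by rewrite mulr_ge0 ?mdist_ge0.
have PN H : P H -> P (- H).
  case=> H1 H2 [S HS]; split=> // [u v|]; first by rewrite !opprK.
  by exists S => u; rewrite oppr_eq0; exact: HS.
have PD (H f : Lip0 o) S' : P H -> `|f| <= K -> (forall u, 0 <= val f u) ->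
    (forall u, val f u != 0 -> val H u = 0) -> concentrated (val f) S' -> P (H + f).
  case=> H1 H2 [S HS] fK f0 fH fS'.
  have fL u v : val f u - val f v <= K * mdist u v.
    exact: le_trans (ler_norm _) (Lip0_ineq u v fK).
  have cases u : val H u = 0 \/ val f u = 0.
    by have [->|/fH] := eqVneq (val f u) 0; [right|left].
  split=> [u v|u v|].
  - rewrite -[val (H + f) u]/(val H u + val f u) -[val (H + f) v]/(val H v + val f v).
    have := H1 u v; have := fL u v; have := f0 u; have := f0 v; have := Kd u v.
    case: (cases u) => ->; case: (cases v) => ->; rewrite ?addr0 ?add0r.
    + by move=> _ *; rewrite !max_l.
    + rewrite maxxx sub0r; move=> ? _ fu ? ?; rewrite (max_l fu).
      by case: (leP (val H v) 0); lra.
    + rewrite maxxx subr0 => ? fv _ _ ?; rewrite (max_l fv); lra.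
    + by [].
  - rewrite -[val (H + f) u]/(val H u + val f u) -[val (H + f) v]/(val H v + val f v).
    have e x : Num.max (- (val H x + val f x)) 0 = Num.max (- val H x) 0.
      case: (cases x) => ->; last by rewrite addr0.
      by rewrite add0r oppr0 maxxx; apply/max_idPr; rewrite oppr_le0.
    by rewrite !e.
  - exists (S ++ S') => u; rewrite -[val (H + f) u]/(val H u + val f u).
    have [->|fu] := eqVneq (val f u) 0; last first.
      by have [s sS us] := fS' u fu => _; exists s; rewrite // mem_cat sS orbT.
    by rewrite addr0 => /HS[s sS us]; exists s; rewrite // mem_cat sS.
apply: (gliding_hump mu_sum (P := P) (C := 2 * K) (c := 1 / 8)).
- lra.
- split=> [u v|u v|]; rewrite -1?[val 0 u]/(0 : R).
  + by rewrite -[val 0 v]/(0 : R) subrr.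
  + by rewrite -[val 0 v]/(0 : R) subrr.
  + by exists [::] => u; rewrite -[val 0 u]/(0 : R) eqxx.
- move=> H [H1 H2 _]; apply: (Lip0_normP _ _).2; first by rewrite mulr_ge0.
  move=> u v; apply/distr_leP.
  rewrite -[val H u]max0_subN -[val H v]max0_subN.
  have := H1 u v; have := H1 v u; have := H2 u v; have := H2 v u.
  by rewrite (metric_sym v u); split; lra.
move=> H nu e n0 PH e0; have [_ _ [S HS]] := PH.
have Kgt0 : 0 < K by lra.
have [t tE] := pairing_approx nu (divr_gt0 e0 Kgt0).
have th2 : 0 < theta / 2 by rewrite divr_gt0.
have [n [p [nn p2 pS pn]]] := mu_small (S ++ [seq x.2 | x <- t]) (maxn n0 n1) th2.
move: nn; rewrite geq_max => /andP[n0n n1n].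
(* These are the positive part of p for s = 1 and that of - p for s = -1; one
   of them pairs with mu n to at least 1 / 4 in absolute value. *)
have part (s : R) : `|s| = 1 -> exists2 q : Lip0 o, `|q| <= 2 &
    val q = (fun u => Num.max (s * val p u) 0).
  move=> s1; have [|||q qE q2] := @Lip0_of _ _ o (fun u => Num.max (s * val p u) 0) 2 => //.
  - by rewrite Lip0_base mulr0 maxxx.
  - move=> u v; have := Lip0_ineq u v p2.
    rewrite -[X in X <= _ -> _]mul1r -s1 -normrM mulrBr => /distr_leP[? ?].
    by apply/distr_leP; split; apply: maxBmax_le => //; rewrite subrr mulr_ge0 ?mdist_ge0.
  by exists q.
have [q1 q12 q1E] := part 1 (normr1 _).
have [q2 q22 q2E] := part (-1) (normrN1 _).
have pE : p = q1 - q2.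
  apply/val_inj/funext => u; rewrite -[val (q1 - q2) u]/(val q1 u - val q2 u) q1E q2E.
  by rewrite mul1r mulN1r max0_subN.
have key (q : Lip0 o) (s : R) : `|s| = 1 -> `|q| <= 2 ->
    val q = (fun u => Num.max (s * val p u) 0) ->
    exists f : Lip0 o, [/\ P (H + f), P (H - f), `|pairing f nu| <= e &
      `|pairing f (mu n) - pairing q (mu n)| <= 1 / 8].
  move=> s1 q2' qE.
  have q0 u : 0 <= val q u by rewrite qE le_max lexx orbT.
  have qS x : x \in S ++ [seq x.2 | x <- t] -> val q x <= theta / 2.
    move=> xS; rewrite qE ge_max (ltW th2) andbT (le_trans (ler_norm _))//.
    by rewrite normrM s1 mul1r pS.
  have [f [fK f0 fH ft [[S' fS'] fmu]]] := detached_bump n1n q2' q0 qS HS.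
  exists f; split=> //.
  - exact: PD fS'.
  - rewrite -[H - f]opprK opprB addrC; apply: (PN).
    apply: PD fS' => //; first exact: PN.
    by move=> u /fH; rewrite -[val (- H) u]/(- val H u) => ->; rewrite oppr0.
  - have := tE f; rewrite big_seq big1 => [|x xt]; last by rewrite ft ?mulr0 ?map_f.
    rewrite subr0 => /le_trans; apply.
    rewrite (@le_trans _ _ (K * (e / K)))// ?ler_wpM2r ?divr_ge0 ?(ltW e0)//.
    by rewrite mulrC divfK// gt_eqF.
move: pn; rewrite pE pairingBl => pn.
have [q1n|q1n] := leP (1 / 4) (pairing q1 (mu n)).
  have [f [Pf _ fnu /ler_normlP[fn _]]] := key _ _ (normr1 _) q12 q1E.
  by exists n, f; split=> //; lra.
have [f [_ Pf fnu /ler_normlP[_ fn]]] := key _ _ (normrN1 _) q22 q2E.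
by exists n, (- f); rewrite !pairingNl normrN; split=> //; lra.
Qed.

End insensitive_case.

(** * Sequences that see functions of small relative size *)

Section lipschitz_extension.
Variables (R : realType) (T : eqType) (D : T -> T -> R).
Hypotheses (Dxx : forall x, D x x = 0) (DC : forall x y, D x y = D y x)
  (DT : forall y x z, D x z <= D x y + D y z).

(** One point of [S] is added at a time, by clamping the previous function
between the two cones that the value at the new point allows. This works for
any pseudometric [D], in particular for a pseudometric that encodes two
Lipschitz conditions at once. *)
Lemma lipschitz_extension (p : T -> R) (S : seq T) :
  {in S &, forall s t, p s - p t <= D s t} ->
  exists2 f, (forall u v, f u - f v <= D u v) & {in S, f =1 p}.
Proof.
have D0 x y : 0 <= D x y by have := DT y x x; rewrite Dxx (DC y); lra.
elim: S => [|t S IH] pS; first by exists (fun=> 0) => // u v; rewrite subrr.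
have [|f fD fS] := IH.
  by move=> s s' sS s'S; apply: pS; rewrite inE ?sS ?s'S orbT.
exists (fun u => Num.max (p t - D u t) (Num.min (p t + D u t) (f u))).
  move=> u v; have := fD u v; have := DT v u t; have := DT u v t; rewrite (DC v u).
  set a := p t - D u t; set b := p t - D v t.
  set a' := Num.min _ _; set b' := Num.min _ _ => h1 h2 h3.
  have ab : a - b <= D u v by rewrite /a /b; lra.
  have ab' : a' - b' <= D u v.
    rewrite /a' /b'.
    by case: (leP (p t + D u t) (f u)); case: (leP (p t + D v t) (f v)); lra.
  by case: (leP a a'); case: (leP b b'); lra.
move=> s; rewrite inE => /predU1P[->|sS].
  rewrite Dxx subr0 addr0; by apply/max_idPl; rewrite ge_min lexx.
rewrite fS//.
have st : p s - p t <= D s t by apply: pS; rewrite ?mem_head// inE sS orbT.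
have ts : p t - p s <= D s t by rewrite DC; apply: pS; rewrite ?mem_head// inE sS orbT.
rewrite (_ : Num.min _ _ = p s); last by apply/min_idPr; lra.
by apply/max_idPr; lra.
Qed.

Lemma clamped_extension (p b : T -> R) (S : seq T) :
  {in S &, forall s t, p s - p t <= D s t} -> (forall u, 0 <= b u) ->
  (forall u v, b u - b v <= D u v) -> {in S, forall s, `|p s| <= b s} ->
  exists f, [/\ forall u v, f u - f v <= D u v, {in S, f =1 p} &
    forall u, `|f u| <= b u].
Proof.
move=> /lipschitz_extension[f fD fS] b0 bD pb.
exists (fun u => Num.max (- b u) (Num.min (b u) (f u))); split.
- move=> u v; apply: maxBmax_le; last exact: minBmin_le.
  by rewrite opprK addrC DC.
- move=> s sS; rewrite fS//; have /ler_normlP[h1 h2] := pb _ sS.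
  by rewrite min_r// max_r//; lra.
- move=> u; rewrite ler_norml le_max lexx /= ge_max ge_min lexx andbT.
  by have := b0 u; lra.
Qed.

End lipschitz_extension.

Section capped_gauge.
Variable R : realType.
Implicit Types s t L : R.

(** Lipschitz for the pseudometric of this gauge means Lipschitz both for
[max_id_sqrt] and, with constant [L], for the norm. *)
Definition capped_gauge L t : R := Num.min (max_id_sqrt t) (L * t).

Lemma max_id_sqrt_ge t : t <= max_id_sqrt t.
Proof. by rewrite le_max lexx. Qed.

Lemma max_id_sqrt_le t : 0 <= t -> max_id_sqrt t <= 1 + t.
Proof.
move=> t0; rewrite ge_max lerDr ler01 /=.
have := sqr_sqrtr t0; have := sqrtr_ge0 t; nra.
Qed.

Lemma le_max_id_sqrt s t : s <= t -> max_id_sqrt s <= max_id_sqrt t.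
Proof.
move=> st; rewrite /max_id_sqrt ge_max !le_max st /=.
by rewrite (ler_wsqrtr st) orbT.
Qed.

Lemma max_id_sqrtD s t : 0 <= s -> 0 <= t ->
  max_id_sqrt (s + t) <= max_id_sqrt s + max_id_sqrt t.
Proof.
move=> s0 t0; have [_ _ _ tri] := @max_id_sqrt_metric R R^o.
have := tri s 0 (s + t); rewrite !sub0r !normrN opprD addrA subrr sub0r normrN.
by rewrite !ger0_norm// addr_ge0.
Qed.

Lemma capped_gauge_le L t : capped_gauge L t <= max_id_sqrt t.
Proof. by rewrite ge_min lexx. Qed.

Lemma capped_gauge_le_lin L t : capped_gauge L t <= L * t.
Proof. by rewrite ge_min lexx orbT. Qed.

Lemma capped_gauge_ge L t : 1 <= L -> 0 <= t -> t <= capped_gauge L t.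
Proof. by move=> L1 t0; rewrite le_min max_id_sqrt_ge ler_peMl. Qed.

Lemma le_capped_gauge L s t : 0 <= L -> s <= t -> capped_gauge L s <= capped_gauge L t.
Proof.
move=> L0 st; rewrite le_min !ge_min le_max_id_sqrt//=.
by rewrite ler_wpM2l// orbT.
Qed.

(** Beyond the point where [max_id_sqrt] meets the line of slope [L], the square
root has slope less than [L], so a step of length [s] there costs at most
[L * s]. *)
Lemma capped_gaugeD_mixed L s t : 1 <= L -> 0 <= s -> 0 <= t ->
  max_id_sqrt t <= L * t -> capped_gauge L (s + t) <= L * s + max_id_sqrt t.
Proof.
move=> L1 s0; rewrite le_eqVlt => /predU1P[<- _|t_gt0 tL].
  by rewrite addr0 (le_trans (capped_gauge_le_lin _ _))// lerDl le_max lexx.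
rewrite ge_min; apply/orP; left; rewrite ge_max; have t0 := ltW t_gt0.
have := max_id_sqrt_ge t => wt; apply/andP; split.
  by apply: lerD => //; rewrite ler_peMl.
apply: (@le_trans _ _ (L * s + Num.sqrt t)); last by rewrite lerD2l le_max lexx orbT.
have := sqrtr_ge0 t; set r := Num.sqrt t => r0.
have rt : t = r ^+ 2 by rewrite sqr_sqrtr.
have rL : r <= L * t by apply: le_trans tL; rewrite le_max lexx orbT.
have Ls : 0 <= L * s by rewrite mulr_ge0// (le_trans ler01).
rewrite -(ler_pXn2r (_ : 0 < 2)%N) ?nnegrE ?sqrtr_ge0 ?addr_ge0//.
rewrite sqr_sqrtr ?addr_ge0// sqrrD -rt.
have r1 : 1 <= L * r.
  have r_gt0 : 0 < r by rewrite sqrtr_gt0.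
  by rewrite -(ler_pM2r r_gt0) mul1r -mulrA -expr2 -rt.
have : s * 1 <= s * (L * r) by rewrite ler_wpM2l.
have := sqr_ge0 (L * s); nra.
Qed.

Lemma capped_gaugeD L s t : 1 <= L -> 0 <= s -> 0 <= t ->
  capped_gauge L (s + t) <= capped_gauge L s + capped_gauge L t.
Proof.
move=> L1 s0 t0; rewrite {2 3}/capped_gauge.
case: (leP (max_id_sqrt s) (L * s)) => hs;
  case: (leP (max_id_sqrt t) (L * t)) => ht.
- by apply: le_trans (capped_gauge_le _ _) _; exact: max_id_sqrtD.
- by rewrite addrC [leRHS]addrC; by apply: capped_gaugeD_mixed => //; exact: ltW.
- by apply: capped_gaugeD_mixed => //; exact: ltW.
- by rewrite -mulrDr; exact: capped_gauge_le_lin.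
Qed.

End capped_gauge.

Lemma exists_uniform_bound (R : realType) (T : eqType) (P : T -> R -> Prop)
    (s : seq T) :
  (forall x K L, K <= L -> P x K -> P x L) -> (forall x, exists L, P x L) ->
  exists2 L : R, 1 <= L & forall x, x \in s -> P x L.
Proof.
move=> Pmono Pex; elim: s => [|t s [L L1 sL]]; first by exists 1.
have [K xK] := Pex t; exists (Num.max L K); first by rewrite le_max L1.
move=> x; rewrite inE => /predU1P[->|/sL].
  by apply: Pmono xK; rewrite le_max lexx orbT.
by apply: Pmono; rewrite le_max lexx.
Qed.

Lemma exists_scale (R : realType) (cs : seq R) :
  exists theta : R, [/\ 0 < theta, theta <= 1 & forall c, c \in cs -> theta * c <= 1].
Proof.
have [||L L1 Lcs] := @exists_uniform_bound R R (fun c L => c <= L) cs.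
- by move=> x K L KL xK; exact: le_trans KL.
- by move=> x; exists x.
have L0 : 0 < L by exact: lt_le_trans L1.
exists L^-1; split=> [||c /Lcs cL]; first by rewrite invr_gt0.
  by rewrite invf_le1.
by rewrite mulrC ler_pdivrMr// mul1r.
Qed.

(** Here [t] is the distance of two points of norms [x] and [y], while [a] and
[b] are the increments of the old and of the new function. The old function has
slope [L] for the norm and vanishes outside the ball of radius [r]. If
[L * t <= omega t], the old increment is at most [omega t] and the new one at
most [2 * omega t]. Otherwise [t >= 1 / L ^+ 2]; either both points lie outside
the ball, and the old increment vanishes, or the new increment is at most
[d * t] because the new function is small near the ball. *)
Lemma perturbed_quotient (R : realType) (A L r theta d t x y a b : R) :
  3 <= A -> 0 < d -> 1 <= L -> 0 < theta -> 0 <= t -> 0 <= r ->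
  theta * (4 + 2 * r) * L ^+ 2 <= d / 2 -> theta <= d / 2 ->
  a <= A * max_id_sqrt t -> a <= L * t -> b <= 2 * max_id_sqrt t ->
  b <= theta * (4 + x + y) -> x <= y + t -> y <= x + t ->
  (r < x -> r < y -> a <= 0) ->
  a + b <= (A + d) * max_id_sqrt t.
Proof.
move=> A3 d0 L1 th0 t0 r0 thr thd; set w := max_id_sqrt t => aA aL bw bth xy yx ar.
have tw : t <= w by exact: max_id_sqrt_ge.
have w0 : 0 <= w by exact: le_trans tw.
have Aw : 3 * w + d * w <= (A + d) * w by rewrite -mulrDl ler_wpM2r// lerD2r.
have dw : 0 <= d * w by rewrite mulr_ge0// ltW.
have [Lw|wL] := leP (L * t) w; first by lra.
have [ab|xyr] : a <= 0 \/ x + y <= 2 * r + t.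
  have [rx|xr] := ltP r x; last by right; lra.
  by have [ry|yr] := ltP r y; [left; exact: ar|right; lra].
  by lra.
have L2t : 1 <= L ^+ 2 * t.
  have tgt : 0 < t.
    rewrite lt_neqAle t0 andbT; apply: contraTneq wL => <-.
    by rewrite mulr0 -leNgt.
  have sL : Num.sqrt t <= L * t.
    by apply: le_trans (ltW wL); rewrite /w /max_id_sqrt le_max lexx orbT.
  have := ler_pM (sqrtr_ge0 t) (sqrtr_ge0 t) sL sL.
  rewrite -!expr2 sqr_sqrtr// exprMn (expr2 t) mulrA.
  by rewrite -[X in X <= _]mul1r ler_pM2r.
have c0 : 0 <= theta * (4 + 2 * r).
  by apply: mulr_ge0; [exact: ltW|rewrite addr_ge0// mulr_ge0].
have h1 : theta * (4 + 2 * r) <= d / 2 * t.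
  apply: le_trans (ler_wpM2r t0 thr); rewrite -[_ * L ^+ 2 * t]mulrA.
  by rewrite ler_peMr.
have h2 : theta * (4 + x + y) <= theta * (4 + 2 * r) + theta * t.
  by rewrite -mulrDr ler_wpM2l ?(ltW th0)//; lra.
have h3 : theta * t <= d / 2 * t by rewrite ler_wpM2r.
have h4 : d * t <= d * w by rewrite ler_wpM2l// ltW.
rewrite mulrDl; lra.
Qed.

Section sensitive_case.
Variables (R : realType) (V : normedModType R).
Local Notation M := (remetrized (@max_id_sqrt_metric R V)).
Local Notation o := (0 : V).
Local Notation M0 := (@Lip0 R M o).

Lemma mdistE (u v : V) : mdist (u : M) (v : M) = max_id_sqrt `|u - v|.
Proof. by []. Qed.

(** On a finite set the two metrics are comparable, which gives the slope [L] for
the norm; the clamp by a tent over the ball containing [S] bounds the support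
without changing the values on [S]. *)
Lemma tame_extension (p : M0) (S : seq V) (theta : R) :
  0 < theta -> theta <= 1 -> `|p| <= 2 ->
  (forall u : V, `|val p u| <= theta * (1 + mdist (u : M) o)) ->
  exists f : M0, [/\ `|f| <= 2, {in S, val f =1 val p},
    forall u : V, `|val f u| <= theta * (2 + `|u|),
    exists2 L : R, 1 <= L & forall u v : V, `|val f u - val f v| <= L * `|u - v| &
    exists2 r : R, 0 <= r & forall u : V, r < `|u| -> val f u = 0].
Proof.
move=> t0 t1 p2 pt.
have [L L1 LS] : exists2 L : R, 1 <= L & {in o :: S &, forall s t : V,
    max_id_sqrt `|s - t| <= L * `|s - t|}.
  have [|x|L L1 LS] := @exists_uniform_bound R (V * V)%type
    (fun x L => max_id_sqrt `|x.1 - x.2| <= L * `|x.1 - x.2|)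
    [seq (s, t) | s <- o :: S, t <- o :: S].
  - by move=> x K L KL xK; apply: le_trans xK _; rewrite ler_wpM2r.
  - exists (max_id_sqrt `|x.1 - x.2| / `|x.1 - x.2|).
    have [->|xn0] := eqVneq `|x.1 - x.2| 0; last by rewrite divfK.
    by rewrite /max_id_sqrt sqrtr0 maxxx mulr0.
  - by exists L => // s t sS tS; apply: (LS (s, t)); apply: allpairs_f.
have [||B B1 BS] := @exists_uniform_bound R V
    (fun s B => theta * (2 + 2 * `|s|) <= B) (o :: S).
- by move=> x A B AB xA; exact: le_trans xA AB.
- by move=> x; exists (theta * (2 + 2 * `|x|)).
pose D (u v : V) := 2 * capped_gauge L `|u - v|.
have L0 : 0 <= L by rewrite (le_trans ler01).
have D1 (u v : V) : `|u - v| <= D u v.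
  have := capped_gauge_ge L1 (normr_ge0 (u - v)); have := normr_ge0 (u - v).
  by rewrite /D; lra.
(* The decreasing side of the tent meets the growth bound outside a ball that
   contains S. *)
pose b (u : V) := Num.min (theta * (2 + `|u|)) (Num.max 0 (B - theta * `|u|)).
have pS : {in o :: S &, forall s t : V, val p s - val p t <= D s t}.
  move=> s t sS tS; apply: le_trans (ler_norm _) _.
  have := Lip0_ineq (s : M) (t : M) p2; rewrite mdistE => /le_trans; apply.
  by rewrite ler_wpM2l// le_min LS// andbT.
have b0 u : 0 <= b u.
  by rewrite le_min le_max lexx andbT mulr_ge0 ?addr_ge0 ?(ltW t0).
have thB (u v : V) : theta * `|u| - theta * `|v| <= `|u - v|.
  rewrite -mulrBr; apply: (@le_trans _ _ (theta * `|u - v|)).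
    by rewrite ler_wpM2l ?(ltW t0)// (le_trans _ (ler_dist_dist _ _))// ler_norm.
  by rewrite ler_piMl.
have bD u v : b u - b v <= D u v.
  apply: le_trans (D1 u v); have := thB u v; have := thB v u.
  rewrite (distrC v u) /b; move: (normr_ge0 (u - v)) => h0 h1 h2.
  by apply: minBmin_le; [|apply: maxBmax_le]; move: h0 h1 h2; clear; lra.
have pb : {in o :: S, forall s, `|val p s| <= b s}.
  move=> s /BS sB; have s0 := normr_ge0 s.
  have ps : `|val p s| <= theta * (2 + `|s|).
    apply: le_trans (pt s) _; rewrite ler_wpM2l ?(ltW t0)//.
    by have := max_id_sqrt_le s0; rewrite mdistE subr0; lra.
  rewrite le_min ps le_max; apply/orP; right; apply: le_trans ps _; lra.
have [|||f [fD fS fb]] := clamped_extension (D := D) _ _ _ pS b0 bD pb.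
- move=> u; rewrite /D subrr normr0 /capped_gauge mulr0 /max_id_sqrt sqrtr0.
  by rewrite !maxxx minxx mulr0.
- by move=> u v; rewrite /D distrC.
- move=> v u w; rewrite /D -mulrDr ler_wpM2l//.
  apply: le_trans (capped_gaugeD L1 (normr_ge0 _) (normr_ge0 _)).
  by apply: le_capped_gauge => //; exact: ler_distD.
have [|||F FE F2] := @Lip0_of R M o f 2 => //.
- by rewrite fS ?mem_head// Lip0_base.
- move=> u v; rewrite mdistE; apply/distr_leP; split.
    by apply: le_trans (fD u v) _; rewrite ler_wpM2l// capped_gauge_le.
  by apply: le_trans (fD v u) _; rewrite distrC ler_wpM2l// capped_gauge_le.
exists F; rewrite FE; split=> //.
- by move=> s sS; apply: fS; rewrite inE sS orbT.
- by move=> u; apply: le_trans (fb u) _; rewrite ge_min lexx.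
- exists (2 * L); first by move: L1; clear; lra.
  move=> u v; apply/distr_leP; rewrite -mulrA; split.
    by apply: le_trans (fD u v) _; rewrite ler_wpM2l// capped_gauge_le_lin.
  by apply: le_trans (fD v u) _; rewrite distrC ler_wpM2l// capped_gauge_le_lin.
- exists (B / theta); first by apply: divr_ge0; [exact: le_trans B1|exact: ltW].
  move=> u; rewrite ltr_pdivrMr// mulrC => Bu; apply/eqP; rewrite -normr_le0.
  apply: le_trans (fb u) _; rewrite ge_min ge_max lexx /= subr_le0 (ltW Bu).
  by rewrite orbT.
Qed.

(** The invariant leaves room below the constant 4: each step may use half of what
remains, and [theta] is chosen after the slope [L] and the radius [r] of the
function constructed so far. *)
Lemma sensitive_case (mu : nat -> free_space (o : M)) :
  (forall s : seq nat, uniq s -> `|\sum_(i <- s) mu i| ^+ 2 <= (size s)%:R) ->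
  ~ forall (theta : R) n0, 0 < theta -> theta <= 1 ->
    exists n (p : M0), [/\ (n0 <= n)%N, `|p| <= 2,
      forall u : V, `|val p u| <= theta * (1 + mdist (u : M) o) &
      1 / 16 <= pairing p (mu n)].
Proof.
move=> mu_sum mu_sensitive.
pose P (H : M0) := [/\ exists A : R, [/\ 3 <= A, A < 4 & `|H| <= A],
  exists2 L : R, 1 <= L & forall u v : V, `|val H u - val H v| <= L * `|u - v| &
  exists2 r : R, 0 <= r & forall u : V, r < `|u| -> val H u = 0].
have c0 : 0 < 1 / 32 :> R by lra.
have c1 : 0 < 1 / 128 :> R by lra.
apply: (gliding_hump mu_sum (P := P) (C := 4) c0).
- split.
  + by exists 3; rewrite normr0; split; clear; lra.
  + by exists 1 => // u v; rewrite subrr normr0 mul1r.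
  + by exists 0.
- by move=> H [[A [_ A4 HA]] _ _]; exact: le_trans HA (ltW A4).
move=> H nu e n0 [[A [A3 A4 HA]] [L L1 HL] [r r0 Hr]] e0.
pose d := (4 - A) / 2.
have d0 : 0 < d by rewrite divr_gt0// subr_gt0.
have [Ad3 Ad4] : 3 <= A + d /\ A + d < 4.
  by rewrite /d; split; move: A3 A4; clear; lra.
have [t tE] := pairing_approx nu (divr_gt0 e0 (ltr0n R 4)).
pose W := \sum_(x <- t) `|x.1| * (2 + `|x.2 : V|).
have [theta [t0 t1 tW tr td]] : exists theta : R, [/\ 0 < theta, theta <= 1,
    theta * W <= e / 2, theta * (4 + 2 * r) * L ^+ 2 <= d / 2 & theta <= d / 2].
  have [theta [t0 t1 tc]] := exists_scale
    [:: W / (e / 2); (4 + 2 * r) * L ^+ 2 / (d / 2); 1 / (d / 2)].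
  have bnd c k : 0 < k -> c / k \in
      [:: W / (e / 2); (4 + 2 * r) * L ^+ 2 / (d / 2); 1 / (d / 2)] -> theta * c <= k.
    by move=> k0 /tc; rewrite mulrA ler_pdivrMr// mul1r.
  have e2 : 0 < e / 2 by rewrite divr_gt0.
  have d2 : 0 < d / 2 by rewrite divr_gt0.
  exists theta; split=> //.
  - by apply: bnd => //; rewrite mem_head.
  - by rewrite -mulrA; apply: bnd => //; rewrite !inE eqxx orbT.
  - by rewrite -[theta]mulr1; apply: bnd => //; rewrite !inE eqxx !orbT.
have [n [p [n0n p2 pt pn]]] := mu_sensitive theta n0 t0 t1.
have [t' t'E] := pairing_approx (mu n) c1.
have [f [f2 fS ft [L' L'1 fL] [r' r'0 fr]]] :=
  @tame_extension p [seq x.2 | x <- t'] theta t0 t1 p2 pt.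
have HfE (u : V) : val (H + f) u = val H u + val f u by [].
exists n, f; split=> //.
- split.
  + exists (A + d); split=> //.
    apply: (Lip0_normP _ _).2 => [|u v]; first exact: le_trans Ad3.
    rewrite !HfE opprD addrACA (le_trans (ler_normD _ _))// mdistE.
    apply: (@perturbed_quotient _ A L r theta d _ `|u : V| `|v : V|) => //.
    * exact: Lip0_ineq u v HA.
    * exact: Lip0_ineq u v f2.
    * apply: le_trans (ler_normB _ _) _; apply: le_trans (lerD (ft u) (ft v)) _.
      by rewrite -mulrDr addrACA -natrD addrA.
    * by rewrite addrC -lerBlDr (le_trans _ (ler_dist_dist _ _))// ler_norm.
    * by rewrite addrC -lerBlDr distrC (le_trans _ (ler_dist_dist _ _))// ler_norm.
    * by move=> ru rv; rewrite !Hr// subrr normr0.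
  + exists (L + L'); first by rewrite (le_trans L1)// lerDl (le_trans _ L'1).
    move=> u v; rewrite !HfE opprD addrACA mulrDl.
    by apply: le_trans (ler_normD _ _) _; apply: lerD.
  + exists (Num.max r r'); first by rewrite le_max r0.
    by move=> u; rewrite gt_max => /andP[ru r'u]; rewrite HfE Hr// fr// addr0.
- have tf : `|\sum_(x <- t) x.1 * val f x.2| <= e / 2.
    apply: le_trans tW; rewrite /W mulr_sumr (le_trans (ler_norm_sum _ _ _))//.
    by apply: ler_sum => x _; rewrite normrM mulrCA ler_wpM2l.
  have := tE f; have : `|f| * (e / 4) <= e / 2.
    have -> : e / 2 = 2 * (e / 4) by field.
    by rewrite ler_wpM2r// divr_ge0// ltW.
  move: tf; rewrite !ler_norml; clear; lra.
- have := t'E f; have := t'E p.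
  have -> : \sum_(x <- t') x.1 * val f x.2 = \sum_(x <- t') x.1 * val p x.2.
    by apply: eq_big_seq => x xt; rewrite fS ?map_f.
  have : `|f| * (1 / 128) <= 2 * (1 / 128) by rewrite ler_wpM2r// ltW.
  have : `|p| * (1 / 128) <= 2 * (1 / 128) by rewrite ler_wpM2r// ltW.
  move: pn; rewrite !ler_norml; clear; lra.
Qed.

End sensitive_case.

Section no_almost_biorthogonal.
Variables (R : realType) (V : normedModType R).
Local Notation M := (remetrized (@max_id_sqrt_metric R V)).
Local Notation o := (0 : V).

(** A pair [n < m] of nearly equal functions on [S] gives [h n - h m], which is
small on [S] and pairs with [mu n] to at least [1 / 2], since [h m] nearly
annihilates [mu n]. *)
Lemma no_almost_biorthogonal (mu : nat -> free_space (o : M)) :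
  (forall s : seq nat, uniq s -> `|\sum_(i <- s) mu i| ^+ 2 <= (size s)%:R) ->
  ~ forall n, exists h, [/\ `|h| <= 1, 3 / 4 <= pairing h (mu n) &
      forall m, (m < n)%N -> `|pairing h (mu m)| <= 1 / 4].
Proof.
move=> mu_sum /choice[h hP].
have mu_small (S : seq M) (e : R) n0 : 0 < e ->
    exists n (p : @Lip0 R M o), [/\ (n0 <= n)%N, `|p| <= 2,
    forall s, s \in S -> `|val p s| <= e & 1 / 2 <= pairing p (mu n)].
  move=> e0; have h1 n : `|h n| <= 1 by have [] := hP n.
  have [n [m [n0n nm hS]]] := nearly_equal_pair h1 S n0 e0.
  exists n, (h n - h m); split=> //.
    by rewrite (le_trans (ler_normB _ _))// (natrD _ 1 1) lerD.
  have [_ hn _] := hP n; have [_ _ /(_ n nm) hm] := hP m.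
  rewrite pairingBl; move: hn hm; rewrite ler_norml => + /andP[_].
  by clear; lra.
have [[theta [n1 [t0 t1 ins]]]|sens] := pselect (exists (theta : R) n1,
    [/\ 0 < theta, theta <= 1 & forall n (p : @Lip0 R M o), (n1 <= n)%N -> `|p| <= 2 ->
      (forall u : M, `|val p u| <= theta * (1 + mdist u o)) ->
      `|pairing p (mu n)| <= 1 / 16]).
  apply: (insensitive_case mu_sum mu_small t0 t1 ins (K := 32 / theta)).
  by rewrite divfK// gt_eqF.
apply: (sensitive_case mu_sum) => theta n0 t0 t1; apply: contrapT => no.
apply: sens; exists theta, n0; split=> // n p n0n p2 pt.
rewrite leNgt; apply/negP => /ltW pn; apply: no; exists n.
have [s|s] := leP 0 (pairing p (mu n)).
  by exists p; split=> //; rewrite -(ger0_norm s).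
exists (- p); split=> //; rewrite ?normrN//.
  by move=> u; rewrite -[val (- p) u]/(- val p u) normrN.
by rewrite pairingNl -(ltr0_norm s).
Qed.

End no_almost_biorthogonal.

(** * Averages over subset sums *)

Section subset_average.
Variables (R : realType) (V Y : normedModType R).
Implicit Types (s : seq V) (f : V -> Y) (z : V).

(** The mean of [f] over the points [z + w], with [w] ranging over the sums of all
subsequences of [s]. For [s] listing [v / 2], [v / 4] and so on, this is the
mean over a dyadic grid of the segment from [z] to [z + v]. *)
Fixpoint subset_average s f z : Y :=
  if s is v :: s' then
    2^-1 *: (subset_average s' f z + subset_average s' f (z + v))
  else f z.

Lemma eq_subset_average s f g z : f =1 g -> subset_average s f z = subset_average s g z.
Proof. by move=> /funext ->. Qed.

Lemma subset_average_shift s f z w :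
  subset_average s f (z + w) = subset_average s (fun y => f (y + w)) z.
Proof.
by elim: s z => //= v s IH z; rewrite IH -addrA (addrC w) addrA IH.
Qed.

Lemma subset_averageZ s a f z :
  subset_average s (fun y => a *: f y) z = a *: subset_average s f z.
Proof.
by elim: s z => //= v s IH z; rewrite !IH -scalerDr !scalerA mulrC.
Qed.

Lemma subset_averageB s f g z :
  subset_average s (fun y => f y - g y) z = subset_average s f z - subset_average s g z.
Proof.
by elim: s z => //= v s IH z; rewrite !IH addrACA -opprD scalerBr.
Qed.

Lemma subset_averageD s f g z :
  subset_average s (fun y => f y + g y) z = subset_average s f z + subset_average s g z.
Proof.
by elim: s z => //= v s IH z; rewrite !IH addrACA scalerDr.
Qed.

Lemma subset_average_cat s1 s2 f z :
  subset_average (s1 ++ s2) f z = subset_average s1 (subset_average s2 f) z.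
Proof. by elim: s1 z => //= v s IH z; rewrite !IH. Qed.

Lemma subset_average_middle s1 v s2 f z :
  subset_average (s1 ++ v :: s2) f z = subset_average (v :: s1 ++ s2) f z.
Proof.
elim: s1 z => //= w s IH z; rewrite !IH /= -!scalerDr; congr (_ *: (_ *: _)).
by rewrite [z + w + v]addrAC addrACA.
Qed.

Lemma subset_average_perm s1 s2 f z : perm_eq s1 s2 ->
  subset_average s1 f z = subset_average s2 f z.
Proof.
elim: s1 s2 z => [|v s1 IH] s2 z.
  by rewrite perm_sym => /perm_nilP ->.
move=> p12; have : v \in s2 by rewrite -(perm_mem p12) mem_head.
move=> /splitPr E; case: E p12 => t1 t2 p12.
rewrite subset_average_middle /= !(IH (t1 ++ t2))//;
  by rewrite -(perm_cons v) (perm_trans p12)// perm_catC /= perm_cons perm_catC.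
Qed.

Section lipschitz.
Variable f : V -> Y.
Hypothesis f1 : forall u v, `|f u - f v| <= `|u - v|.

Let half_le (a b : Y) (r : R) : `|a| <= r -> `|b| <= r -> `|2^-1 *: (a + b)| <= r.
Proof.
move=> ar br; rewrite normrZ ger0_norm ?invr_ge0// ler_pdivrMl//.
by rewrite (le_trans (ler_normD _ _))// mulr_natl mulr2n lerD.
Qed.

Lemma subset_average_lipschitz s u v :
  `|subset_average s f u - subset_average s f v| <= `|u - v|.
Proof.
elim: s u v => [//|w s IH] u v /=; rewrite -scalerBr opprD addrACA.
by apply: half_le => //; rewrite (le_trans (IH _ _))// opprD addrACA subrr addr0.
Qed.

Lemma subset_average_near s z :
  `|subset_average s f z - f z| <= \sum_(v <- s) `|v|.
Proof.
elim: s z => [z|w s IH z] /=; first by rewrite big_nil subrr normr0.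
have fE : f z = 2^-1 *: (f z + f z).
  by rewrite -[f z + f z]mulr2n -[f z *+ 2]scaler_nat scalerA mulVf ?scale1r.
rewrite big_cons [X in _ - X]fE -scalerBr opprD addrACA; apply: half_le.
  by apply: le_trans (IH z) _; rewrite lerDr.
rewrite -[_ - f z](subrKA (f (z + w))) addrC (le_trans (ler_normD _ _))// lerD//.
by rewrite (le_trans (f1 _ _))// addrAC subrr add0r.
Qed.

End lipschitz.

(** Averaging commutes with the linear form [l], and a form that is nearly affine
along [f] remains so, the offsets contributing the mean of [psi]. *)
Lemma subset_average_affine (l : Y -> R) (psi : V -> R) f (c e : R) s z :
  (forall a y y', l (a *: y + y') = a * l y + l y') ->
  (forall x y, psi (x + y) = psi x + psi y) ->
  (forall y, `|y| <= `|z| + \sum_(v <- s) `|v| -> `|l (f y) - (c + psi y)| <= e) ->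
  `|l (subset_average s f z) - (c + psi z + 2^-1 * \sum_(v <- s) psi v)| <= e.
Proof.
move=> llin psiD; have l0 : l 0 = 0.
  by have := llin 1 0 0; rewrite scaler0 addr0 mul1r -[LHS]addr0 => /addrI.
elim: s z => [|w s IH] z fz /=.
  by rewrite !big_nil mulr0 addr0; apply: fz; rewrite big_nil addr0.
have lD y y' : l (y + y') = l y + l y' by have := llin 1 y y'; rewrite scale1r mul1r.
have lZ a y : l (a *: y) = a * l y by have := llin a y 0; rewrite l0 !addr0.
have h1 : `|l (subset_average s f z) - (c + psi z + 2^-1 * \sum_(v <- s) psi v)| <= e.
  apply: IH => y yz; apply: fz; rewrite big_cons (le_trans yz)// lerD2l.
  by rewrite lerDr.
have h2 : `|l (subset_average s f (z + w)) -
    (c + psi (z + w) + 2^-1 * \sum_(v <- s) psi v)| <= e.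
  apply: IH => y yz; apply: fz; rewrite big_cons (le_trans yz)// addrA lerD2r.
  exact: ler_normD.
move: h1 h2; rewrite big_cons lZ lD psiD !ler_norml; clear; lra.
Qed.

End subset_average.

(** * Linearizing a Lipschitz map along a sequence of directions *)

Section linearization.
Variables (R : realType) (V : normedModType R) (Y : completeNormedModType R).
Variables (g : V -> Y) (e : nat -> V).
Hypotheses (g1 : forall u v, `|g u - g v| <= `|u - v|) (e1 : forall n, `|e n| <= 1).

Let h (m : nat) : R := 2^-1 ^+ m.

Let h_gt0 m : 0 < h m. Proof. by rewrite exprn_gt0// invr_gt0. Qed.

Let h_ge0 m : 0 <= h m. Proof. exact: ltW. Qed.

Let pow_h m : 2 ^+ m * h m = 1.
Proof. by rewrite -exprMn mulfV ?expr1n. Qed.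

Let hS m : h m = h m.+1 + h m.+1.
Proof. by rewrite -mulr2n -mulr_natl /h exprS mulrA mulfV ?mul1r. Qed.

(** A pair [(i, m)] stands for the binary digit [2^-m] in direction [i], which
starts at level [i + 1], so that its digits fill a segment of length [2^-i]. *)
Fixpoint digit_index M : seq (nat * nat) :=
  if M is M'.+1 then [seq (i, M) | i <- iota 0 M] ++ digit_index M' else [::].

Lemma digit_indexS M :
  digit_index M.+1 = [seq (i, M.+1) | i <- iota 0 M.+1] ++ digit_index M.
Proof. by []. Qed.

Definition digit (x : nat * nat) : V := h x.2 *: e x.1.

Definition digits M := [seq digit x | x <- digit_index M].

Definition other_digits i M := [seq digit x | x <- digit_index M & x.1 != i].

Definition own_digits i M := [seq digit x | x <- digit_index M & x.1 == i].

Definition diff_quotient (f : V -> Y) i m z : Y := 2 ^+ m *: (f (z + h m *: e i) - f z).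

(** The step equals the mesh of the grid: this makes the sum over the grid
telescope in each direction. *)
Definition mean_slope M i : Y := diff_quotient (subset_average (digits M) g) i M 0.

Lemma digits_perm i M : perm_eq (digits M) (other_digits i M ++ own_digits i M).
Proof.
rewrite /digits /other_digits /own_digits -map_cat perm_map// perm_sym perm_catC.
by rewrite (perm_filterC (fun x => x.1 == i)).
Qed.

Lemma quotient_average s f i m z :
  diff_quotient (subset_average s f) i m z = subset_average s (diff_quotient f i m) z.
Proof.
by rewrite /diff_quotient subset_average_shift -subset_averageB -subset_averageZ.
Qed.

Lemma average_quotient_halve f i m z :
  2^-1 *: (diff_quotient f i m.+1 z + diff_quotient f i m.+1 (z + h m.+1 *: e i)) =
  diff_quotient f i m z.
Proof.
rewrite /diff_quotient -scalerDr scalerA exprS mulrA mulVf// mul1r addrC subrKA.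
by rewrite -addrA -scalerDl -hS.
Qed.

Lemma own_digits_eq0 i M : (M <= i)%N -> own_digits i M = [::].
Proof.
rewrite /own_digits; elim: M => [//|M IH] Mi.
rewrite digit_indexS filter_cat map_cat IH 1?ltnW// cats0 filter_map.
rewrite (@eq_in_filter _ _ pred0) ?filter_pred0// => j.
rewrite mem_iota /= add0n => jM; apply/negbTE.
by rewrite neq_ltn (leq_trans jM).
Qed.

Lemma own_digitsS i M : (i <= M)%N -> own_digits i M.+1 = digit (i, M.+1) :: own_digits i M.
Proof.
move=> iM; rewrite /own_digits digit_indexS filter_cat map_cat filter_map.
rewrite (@eq_in_filter _ _ (pred1 i)) => [|j _ //].
by rewrite filter_pred1_uniq ?iota_uniq ?mem_iota//= add0n ltnS.
Qed.

(** Averaging difference quotients over one more binary digit doubles the step, so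
the average over all digits of direction [i] telescopes to the quotient over
the whole side of the cube. *)
Lemma own_digits_quotient f i M z : (i <= M)%N ->
  subset_average (own_digits i M) (diff_quotient f i M) z = diff_quotient f i i z.
Proof.
elim: M z => [|M IH] z.
  by rewrite leqn0 => /eqP ->; rewrite own_digits_eq0.
rewrite leq_eqVlt => /predU1P[->|]; first by rewrite own_digits_eq0.
rewrite ltnS => iM; rewrite own_digitsS//= subset_average_shift.
rewrite -subset_averageD -subset_averageZ -IH//.
by apply: eq_subset_average => y; exact: average_quotient_halve.
Qed.

(** Written with the long step [2^-i], the slope no longer depends on the fine
mesh except through an average over the other directions, which is stable
under refinement and equicontinuous. *)
Lemma quotient_digits i M z : (i <= M)%N ->
  diff_quotient (subset_average (digits M) g) i M z =
  diff_quotient (subset_average (other_digits i M) g) i i z.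
Proof.
move=> iM; rewrite !quotient_average (subset_average_perm _ _ (digits_perm i M)).
rewrite subset_average_cat; apply: eq_subset_average => y.
exact: own_digits_quotient.
Qed.

Lemma digit_norm x : `|digit x| <= h x.2.
Proof. by rewrite normrZ ger0_norm// ler_piMr. Qed.

(** This is [\sum_(m > M) m * 2^-m], which bounds the total length of the digits of
level beyond [M]. *)
Definition digit_tail M : R := (M + 2)%:R * h M.

Lemma digit_tailS M : digit_tail M - digit_tail M.+1 = M.+1%:R * h M.+1.
Proof.
rewrite /digit_tail [h M]hS; move: (h M.+1) => x.
by rewrite -[M.+1]addn1 !natrD; ring.
Qed.

Lemma level_norm M (P : pred (nat * nat)) :
  \sum_(v <- [seq digit x | x <- [seq (i, M.+1) | i <- iota 0 M.+1] & P x]) `|v|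
    <= digit_tail M - digit_tail M.+1.
Proof.
rewrite big_map big_filter big_map big_mkcond /=.
apply: (@le_trans _ _ (\sum_(i <- iota 0 M.+1) h M.+1)).
  apply: ler_sum => i _; case: ifP => // _; exact: (digit_norm (i, M.+1)).
by rewrite big_const_seq count_predT size_iota iter_addr_0 digit_tailS mulr_natl.
Qed.

Lemma other_digits_norm i M : \sum_(v <- other_digits i M) `|v| <= 2.
Proof.
apply: (@le_trans _ _ (digit_tail 0 - digit_tail M)); last first.
  by rewrite /digit_tail /h expr0 mulr1 lerBlDr lerDl mulr_ge0.
elim: M => [|M IH]; first by rewrite /other_digits big_nil subrr.
rewrite /other_digits digit_indexS filter_cat map_cat big_cat /=.
apply: le_trans (lerD (level_norm M (fun x => x.1 != i)) IH) _.
by rewrite addrC subrKA.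
Qed.

Lemma mean_slopeE i M : (i <= M)%N ->
  mean_slope M i = diff_quotient (subset_average (other_digits i M) g) i i 0.
Proof. exact: quotient_digits. Qed.

Lemma quotient_dist (f f' : V -> Y) i (c : R) u v :
  `|f u - f' v| <= c -> `|f (u + h i *: e i) - f' (v + h i *: e i)| <= c ->
  `|diff_quotient f i i u - diff_quotient f' i i v| <= 2 ^+ i * (c + c).
Proof.
move=> h1 h2; rewrite /diff_quotient -scalerBr normrZ ger0_norm ?exprn_ge0//.
rewrite ler_wpM2l ?exprn_ge0// opprB [f' v - _]addrC addrACA.
by rewrite (le_trans (ler_normD _ _))// lerD// addrC distrC.
Qed.

Lemma mean_slope_step i M : (i <= M)%N ->
  `|mean_slope M.+1 i - mean_slope M i| <= 2 ^+ i * 2 * (digit_tail M - digit_tail M.+1).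
Proof.
move=> iM; rewrite !mean_slopeE ?(leqW iM)// -mulrA mulr_natl mulr2n.
rewrite /other_digits digit_indexS filter_cat map_cat.
have near z : `|subset_average ([seq digit x | x <-
      [seq (i, M.+1) | i <- iota 0 M.+1] & x.1 != i] ++ other_digits i M) g z -
    subset_average (other_digits i M) g z| <= digit_tail M - digit_tail M.+1.
  rewrite subset_average_cat.
  apply: le_trans (level_norm M (fun x => x.1 != i)).
  by apply: subset_average_near; exact: subset_average_lipschitz.
by apply: quotient_dist; exact: near.
Qed.

Lemma mean_slope_dist i M N : (i <= M)%N -> (M <= N)%N ->
  `|mean_slope N i - mean_slope M i| <= 2 ^+ i * 2 * (digit_tail M - digit_tail N).
Proof.
move=> iM; elim: N => [|N IH].
  by rewrite leqn0 => /eqP ->; rewrite !subrr normr0 mulr0.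
rewrite leq_eqVlt => /predU1P[<-|]; first by rewrite !subrr normr0 mulr0.
rewrite ltnS => MN; have h1 := mean_slope_step (leq_trans iM MN).
rewrite -(subrKA (mean_slope N i)) (le_trans (ler_normD _ _))//.
rewrite (le_trans (lerD h1 (IH MN)))//.
by rewrite -mulrDr addrC subrKA.
Qed.

Lemma digit_tail_nonincreasing : nonincreasing_seq digit_tail.
Proof.
by apply/nonincreasing_seqP => n; rewrite -subr_ge0 digit_tailS mulr_ge0.
Qed.

Lemma digit_tail_cvg : cvgn digit_tail.
Proof.
apply: nonincreasing_is_cvgn digit_tail_nonincreasing _.
by exists 0 => _ [n _ <-]; rewrite mulr_ge0.
Qed.

(** The bound by differences of the convergent sequence [digit_tail] makes the
slopes a Cauchy sequence. *)
Lemma mean_slope_cvg i : cvgn (mean_slope ^~ i).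
Proof.
apply/cauchy_cvgP/cauchy_exP => eps eps0.
have c0 : 0 < 2 ^+ i * 2 :> R by rewrite mulr_gt0// exprn_gt0.
have /cvgrPdist_lt/(_ _ (divr_gt0 eps0 c0)) tc := digit_tail_cvg.
have [M [tM iM]] := filter_ex (filterI tc (nbhs_infty_ge i)).
exists (mean_slope M i).
suff : \forall N \near \oo, ball (mean_slope M i) eps (mean_slope N i) by [].
near=> N; rewrite -ball_normE /= distrC.
have MN : (M <= N)%N by near: N; exact: nbhs_infty_ge.
apply: le_lt_trans (mean_slope_dist (iM : (i <= M)%N) MN) _.
rewrite mulrC -ltr_pdivlMr//; apply: le_lt_trans tM.
rewrite distrC (le_trans _ (ler_norm _))// lerB//.
exact: nonincreasing_cvgn_ge digit_tail_nonincreasing digit_tail_cvg _.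
Unshelve. all: by end_near. Qed.

Definition slope i : Y := limn (mean_slope ^~ i).

Lemma quotient_digits_dist i M z w : (i <= M)%N ->
  `|diff_quotient (subset_average (digits M) g) i M z -
    diff_quotient (subset_average (digits M) g) i M w| <= 2 ^+ i * 2 * `|z - w|.
Proof.
move=> iM; rewrite !quotient_digits// -mulrA mulr_natl mulr2n.
apply: quotient_dist; first exact: subset_average_lipschitz.
rewrite (le_trans (subset_average_lipschitz _ _ _ _))//.
by rewrite opprD addrACA subrr addr0.
Qed.

(** The averaged map is nearly additive on steps of one mesh: passing from one
base point to another at distance [h M * `|w|] changes its slope in direction
[i] by a multiple of [h M]. *)
Lemma mean_slope_sum (s : seq nat) : exists c N, forall M, (N <= M)%N ->
  `|\sum_(i <- s) mean_slope M i -
    2 ^+ M *: (subset_average (digits M) g (h M *: \sum_(i <- s) e i) -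
               subset_average (digits M) g 0)| <= c * h M.
Proof.
elim: s => [|i s [c [N cN]]].
  by exists 0, 0%N => M _; rewrite !big_nil scaler0 subrr scaler0 subrr normr0 mul0r.
set w := \sum_(j <- s) e j in cN.
exists (2 ^+ i * 2 * `|w| + c), (maxn i N) => M; rewrite geq_max => /andP[iM NM].
rewrite !big_cons -/w; set G := subset_average (digits M) g in cN *.
have -> : 2 ^+ M *: (G (h M *: (e i + w)) - G 0) =
    diff_quotient G i M (h M *: w) + 2 ^+ M *: (G (h M *: w) - G 0).
  by rewrite /diff_quotient -scalerDr subrKA -scalerDr [w + _]addrC.
rewrite opprD addrACA (le_trans (ler_normD _ _))// mulrDl lerD//; last exact: cN.
rewrite distrC (le_trans (quotient_digits_dist _ _ iM))// subr0 normrZ.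
by rewrite ger0_norm// mulrCA mulrC.
Qed.

Lemma slope_cvg i : mean_slope M i @[M --> \oo] --> slope i.
Proof. exact: mean_slope_cvg. Qed.

Lemma slope_sum (s : seq nat) : `|\sum_(i <- s) slope i| <= `|\sum_(i <- s) e i|.
Proof.
have [c [N cN]] := mean_slope_sum s.
have cvgl : `|\sum_(i <- s) mean_slope M i| @[M --> \oo] --> `|\sum_(i <- s) slope i|.
  apply: cvg_norm; apply: cvg_big => [|i _]; last exact: slope_cvg.
  exact: add_continuous.
have cvgr : `|\sum_(i <- s) e i| + c * h M @[M --> \oo] --> `|\sum_(i <- s) e i|.
  rewrite -[X in _ --> X]addr0; apply: cvgD; first exact: cvg_cst.
  by apply: cvg_geometric; rewrite ger0_norm ?invr_ge0// invf_lt1// ltr1n.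
rewrite -(cvg_lim (@Rhausdorff R) cvgl) -(cvg_lim (@Rhausdorff R) cvgr).
apply: ler_lim; [exact: cvgP cvgl|exact: cvgP cvgr|].
near=> M; have /cN : (N <= M)%N by near: M; exact: nbhs_infty_ge.
set G := subset_average _ _; set w := \sum_(i <- s) e i => GM.
rewrite -[X in `|X|](subrK (2 ^+ M *: (G (h M *: w) - G 0))) addrC.
rewrite (le_trans (ler_normD _ _))// lerD//.
have -> : `|w| = 2 ^+ M * (h M * `|w|) by rewrite mulrA pow_h mul1r.
rewrite normrZ ger0_norm ?exprn_ge0//.
rewrite ler_wpM2l ?exprn_ge0// (le_trans (subset_average_lipschitz _ _ _ _))//.
by rewrite subr0 normrZ ger0_norm.
Unshelve. all: by end_near. Qed.

(** All points of the grids lie in the ball of radius 3, and the long step [2^-i]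
amplifies the error of the affine approximation by [2 * 2 ^+ i]. *)
Lemma slope_affine (l : Y -> R) (psi : V -> R) (C c eps : R) i :
  (forall a y y', l (a *: y + y') = a * l y + l y') -> (forall y, `|l y| <= C * `|y|) ->
  (forall a x x', psi (a *: x + x') = a * psi x + psi x') ->
  (forall y, `|y| <= 3 -> `|l (g y) - (c + psi y)| <= eps) ->
  `|l (slope i) - psi (e i)| <= 2 ^+ i * 2 * eps.
Proof.
move=> llin lC psilin lg.
have psiD x x' : psi (x + x') = psi x + psi x'.
  by have := psilin 1 x x'; rewrite scale1r mul1r.
have psi0 : psi 0 = 0 by have := psiD 0 0; rewrite addr0 -[LHS]addr0 => /addrI.
have psiZ a x : psi (a *: x) = a * psi x by have := psilin a x 0; rewrite psi0 !addr0.
have lD y y' : l (y + y') = l y + l y' by have := llin 1 y y'; rewrite scale1r mul1r.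
have l0 : l 0 = 0 by have := lD 0 0; rewrite addr0 -[LHS]addr0 => /addrI.
have lZ a y : l (a *: y) = a * l y by have := llin a y 0; rewrite l0 !addr0.
have lB y y' : l (y - y') = l y - l y' by rewrite lD -scaleN1r lZ mulN1r.
have mean M : (i <= M)%N -> `|l (mean_slope M i) - psi (e i)| <= 2 ^+ i * 2 * eps.
  move=> iM; rewrite mean_slopeE// /diff_quotient add0r lZ lB.
  set A := subset_average _ _.
  have hl : h i <= 1 by rewrite exprn_ile1 ?invr_ge0// invf_le1// ler1n.
  have affine z : `|z| <= 1 -> `|l (A z) -
      (c + psi z + 2^-1 * \sum_(v <- other_digits i M) psi v)| <= eps.
    move=> z1; apply: subset_average_affine => // y yz; apply: lg.
    by rewrite (le_trans yz)// (natrD _ 1 2) lerD// other_digits_norm.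
  have A1 : `|l (A (h i *: e i)) -
      (c + psi (h i *: e i) + 2^-1 * \sum_(v <- other_digits i M) psi v)| <= eps.
    by apply: affine; rewrite normrZ ger0_norm// mulr_ile1.
  have A0 : `|l (A 0) - (c + psi 0 + 2^-1 * \sum_(v <- other_digits i M) psi v)| <= eps.
    by apply: affine; rewrite normr0.
  rewrite psiZ in A1; rewrite psi0 in A0.
  have -> : psi (e i) = 2 ^+ i * (h i * psi (e i)) by rewrite mulrA pow_h mul1r.
  rewrite -mulrBr normrM ger0_norm ?exprn_ge0//.
  rewrite -mulrA ler_wpM2l ?exprn_ge0//.
  by move: A1 A0; rewrite !ler_norml; clear; lra.
apply/ler_addgt0Pr => d d0; have C0 : 0 < `|C| + 1 by rewrite ltr_wpDl.
have /cvgrPdist_lt/(_ _ (divr_gt0 d0 C0)) near_slope := @slope_cvg i.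
have [M [Md iM]] := filter_ex (filterI near_slope (nbhs_infty_ge i)).
rewrite -[l (slope i)](subrK (l (mean_slope M i))) -lB -addrA addrC.
rewrite (le_trans (ler_normD _ _))// lerD ?mean//.
rewrite (le_trans (lC _))// (@le_trans _ _ ((`|C| + 1) * `|slope i - mean_slope M i|))//.
  by rewrite ler_wpM2r// (le_trans (ler_norm _))// lerDl.
by rewrite mulrC -ler_pdivlMr// ltW.
Qed.

End linearization.

(** * Nonlinear isometries of l2 into the free space *)

Section ell2_basis.
Variable R : realType.
Implicit Types x y : ell2 R.

Lemma ell2_normE x : `|x| ^+ 2 = limn (series (fun n => val x n ^+ 2)).
Proof.
rewrite -[`|x|]/(ell2_norm x) sqr_sqrtr//.
have xc : cvgn (series (fun n => val x n ^+ 2)) by have := valP x; rewrite inE.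
apply: le_trans (nondecreasing_cvgn_le (sum_sqr_nd (val x)) xc 0%N).
by rewrite /series /= big_nil.
Qed.

Lemma ell2_norm_cvg x : series (fun n => val x n ^+ 2) n @[n --> \oo] --> `|x| ^+ 2.
Proof. by rewrite ell2_normE; have := valP x; rewrite inE. Qed.

Lemma series_sqr_add (x : nat -> R) (s : R) n N : (n < N)%N ->
  series (fun k => (x k + s * (k == n)%:R) ^+ 2) N =
  series (fun k => x k ^+ 2) N + (2 * s * x n + s ^+ 2).
Proof.
move=> nN; rewrite /series /= !big_mkord (bigD1 (Ordinal nN)) //=.
rewrite [in RHS](bigD1 (Ordinal nN)) //= eqxx mulr1.
rewrite (eq_bigr (fun i : 'I_N => x i ^+ 2)) => [|i]; first by ring.
by rewrite -val_eqE /= => /negbTE ->; rewrite mulr0 addr0.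
Qed.

Lemma ell2_basis_subproof n : (fun k => (k == n)%:R : R^o) \in @square_summable R.
Proof.
apply/square_summableP; exists 1 => N.
apply: (@le_trans _ _ (series (fun k => (k == n)%:R ^+ 2) (n + N).+1)).
  by apply: (sum_sqr_nd (fun k => (k == n)%:R)); rewrite -addSn leq_addl.
have := @series_sqr_add (fun=> 0) 1 n (n + N).+1; rewrite ltnS leq_addr => /(_ isT).
rewrite {2}/series /= [X in _ = X + _]big1 => [|i _]; last by rewrite expr0n.
under eq_fun do rewrite add0r mul1r; move=> ->.
by rewrite mulr0 !add0r expr1n.
Qed.

Definition ell2_basis n : ell2 R :=
  Sub (fun k => (k == n)%:R : R^o) (ell2_basis_subproof n).

Lemma ell2_basisE n k : val (ell2_basis n) k = (k == n)%:R.
Proof. by []. Qed.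

Lemma ell2_addE x y k : val (x + y) k = val x k + val y k. Proof. by []. Qed.

Lemma ell2_scaleE (a : R) x k : val (a *: x) k = a * val x k. Proof. by []. Qed.

Lemma ell2_norm_add_basis x (s : R) n :
  `|x + s *: ell2_basis n| ^+ 2 = `|x| ^+ 2 + (2 * s * val x n + s ^+ 2).
Proof.
rewrite ell2_normE; apply: cvg_lim; first exact: Rhausdorff.
have : series (fun k => val x k ^+ 2) N + (2 * s * val x n + s ^+ 2) @[N --> \oo]
    --> `|x| ^+ 2 + (2 * s * val x n + s ^+ 2).
  by apply: cvgD; [exact: ell2_norm_cvg|exact: cvg_cst].
apply: cvg_trans; apply: near_eq_cvg; near=> N; apply/esym/series_sqr_add.
by near: N; exact: nbhs_infty_gt.
Unshelve. all: by end_near. Qed.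

Lemma ell2_basis_norm n : `|ell2_basis n| = 1.
Proof.
have := ell2_norm_add_basis 0 1 n; rewrite add0r scale1r normr0.
rewrite -[val 0 n]/(0 : R) mulr0 !expr0n /= !add0r expr1n => /eqP.
by rewrite sqrf_eq1 => /orP[/eqP//|/eqP N1]; have := normr_ge0 (ell2_basis n); rewrite N1; lra.
Qed.

Lemma ell2_sum_basis_norm (s : seq nat) : uniq s ->
  `|\sum_(i <- s) ell2_basis i| ^+ 2 = (size s)%:R.
Proof.
elim: s => [|n s IH /=]; first by rewrite big_nil normr0 expr0n.
move=> /andP[ns /IH {}IH]; rewrite big_cons addrC -[ell2_basis n]scale1r.
rewrite ell2_norm_add_basis IH expr1n mulr1 -[(size s).+1%:R]natr1.
suff -> : val (\sum_(i <- s) ell2_basis i) n = 0 by rewrite mulr0 add0r.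
elim: s ns {IH} => [|m s IH]; first by rewrite big_nil.
rewrite inE negb_or => /andP[nm ns]; rewrite big_cons ell2_addE IH//.
by rewrite ell2_basisE (negbTE nm) addr0.
Qed.

(** A ball of huge radius [t] looks like a half-space: the distance to a far point
is affine up to [`|x| ^+ 2 / (2 * t)]. *)
Lemma ell2_norm_far x n (t : R) : 0 < t -> `|val x n| <= t ->
  `|x + t *: ell2_basis n| <= t + val x n + `|x| ^+ 2 / (2 * t).
Proof.
move=> t0; rewrite ler_norml => /andP[xt _].
have q0 : 0 <= `|x| ^+ 2 / (2 * t) by rewrite divr_ge0 ?mulr_ge0// ltW.
rewrite -(ler_pXn2r (_ : 0 < 2)%N) ?nnegrE//; last by lra.
rewrite ell2_norm_add_basis; set q := _ / _ in q0 *.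
have -> : `|x| ^+ 2 = 2 * t * q by rewrite /q mulrC divfK// gt_eqF// mulr_gt0.
have := sqr_ge0 (val x n + q); rewrite !expr2; lra.
Qed.

End ell2_basis.

Section no_isometry.
Variable R : realType.
Local Notation M := (remetrized (@max_id_sqrt_metric R (ell2 R))).
Local Notation o := (0 : ell2 R).

Section coordinate_functional.
Variables (N : metricType R) (p : N) (g : ell2 R -> free_space p).
Hypothesis gI : forall x y, `|g x - g y| = `|x - y|.

(** If [h] almost attains the norm of [g u - g (- u)], where [u] is a large
multiple of the basis vector, then [h o g] increases at nearly full speed from
[- u] to [u]. Being 1-Lipschitz, it is squeezed at [y] between the values
prescribed by the distances of [y] to [- u] and to [u]. *)
Lemma coordinate_functional n (r eps : R) : 0 < r -> 0 < eps ->
  exists2 h, `|h| <= 1 & exists c, forall y : ell2 R, `|y| <= r ->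
    `|pairing h (g y) - (c + val y n)| <= eps.
Proof.
(* With this radius the flatness error r ^+ 2 / (2 * t) is at most eps / 2. *)
move=> r0 eps0; pose t := r + r ^+ 2 / eps; pose u := t *: ell2_basis R n.
have t0 : 0 < t by rewrite addr_gt0// divr_gt0// exprn_gt0.
have eps2 : 0 < eps / 2 by rewrite divr_gt0.
have [h h1 hu] := pairing_norming (g u - g (- u)) eps2.
have u2 : `|g u - g (- u)| = 2 * t.
  rewrite gI opprK -mulr2n -scaler_nat scalerA normrZ ell2_basis_norm mulr1.
  by rewrite gtr0_norm// mulr_gt0.
have hL x y : pairing h (g x) - pairing h (g y) <= `|x - y|.
  rewrite -pairingBr (le_trans (ler_norm _))// (le_trans (pairing_le _ _))// gI.
  by rewrite ler_piMl.
exists h => //; exists ((pairing h (g u) + pairing h (g (- u))) / 2) => y yr.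
have rt : r <= t by rewrite lerDl divr_ge0 ?sqr_ge0// ltW.
have yt (x : ell2 R) : `|x| <= r -> `|val x n| <= t.
  by move=> xr; apply: le_trans (ell2_coord_le x n) (le_trans xr rt).
have yq : `|y| ^+ 2 / (2 * t) <= eps / 2.
  rewrite ler_pdivrMr ?mulr_gt0// (_ : eps / 2 * (2 * t) = eps * t); last by field.
  rewrite /t mulrDr [eps * (_ / _)]mulrC divfK ?gt_eqF//.
  rewrite -[leLHS]add0r lerD ?mulr_ge0 ?(ltW eps0) ?(ltW r0)//.
  by rewrite ler_pXn2r ?nnegrE// ltW.
have up := ell2_norm_far t0 (yt y yr).
have := @ell2_norm_far R (- y) n t t0.
rewrite normrN => /(_ (yt y yr)); rewrite normrN.
rewrite -[val (- y) n]/(- val y n) => lo.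
have h1' := hL y (- u); rewrite opprK in h1'.
have h2 := hL u y; rewrite -[u - y]addrC in h2.
move: hu; rewrite u2 pairingBr; move: up lo yq h1' h2; rewrite -/u ler_norml.
move: (pairing h (g u)) (pairing h (g (- u))) (pairing h (g y)) => a b c.
move: `|y + u| `|- y + u| (val y n : R) (`|y| ^+ 2 / (2 * t)) => A B C D.
by clear; lra.
Qed.

End coordinate_functional.

(** The tolerance [1 / (8 * 2 ^+ n)] compensates the amplification by [2 * 2 ^+ m]
for all [m <= n]. *)
Lemma no_isometry (g : ell2 R -> free_space (o : M)) :
  ~ forall x y, `|g x - g y| = `|x - y|.
Proof.
move=> gI; have g1 x y : `|g x - g y| <= `|x - y| by rewrite gI.
have b1 n : `|ell2_basis R n| <= 1 by rewrite ell2_basis_norm.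
apply: (@no_almost_biorthogonal R (ell2 R) (slope g (ell2_basis R))).
  move=> s us; rewrite -(ell2_sum_basis_norm R us) ler_pXn2r ?nnegrE//.
  exact: slope_sum.
move=> n; have eps0 : 0 < (2 ^+ n * 8)^-1 :> R by rewrite invr_gt0 mulr_gt0// exprn_gt0.
have [h h1 [c hc]] := coordinate_functional gI n (ltr0n R 3) eps0.
have key m : (m <= n)%N -> `|pairing h (slope g (ell2_basis R) m) - (n == m)%:R| <= 1 / 4.
  move=> mn; rewrite -(ell2_basisE R m n).
  apply: le_trans (@slope_affine _ _ _ _ _ g1 b1 (pairing h) (fun y => val y n)
    `|h| c _ m _ _ _ hc) _.
  - by move=> a y y'; rewrite pairingDr pairingZr.
  - by move=> y; exact: pairing_le.
  - by [].
  - rewrite ler_pdivrMr ?mulr_gt0 ?exprn_gt0//.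
    have : 2 ^+ m <= 2 ^+ n :> R by rewrite ler_weXn2l// ler1n.
    clear; lra.
exists h; split=> //.
  by have := key n (leqnn n); rewrite eqxx mulr1n ler_norml; clear; lra.
by move=> m mn; have := key m (ltnW mn); rewrite gtn_eqF// subr0.
Qed.

End no_isometry.

(** * Separability and the almost isometries *)

Section rational_combinations.
Variables (R : realType) (V : normedModType R) (I : countType) (d : I -> V).

Definition rational_combination (s : seq (rat * I)) : V :=
  \sum_(p <- s) ratr p.1 *: d p.2.

Lemma rational_combination_dense :
  (forall x (e : R), 0 < e -> exists s : seq (R * I), `|x - \sum_(p <- s) p.1 *: d p.2| < e) ->
  forall x (e : R), 0 < e -> exists s, `|x - rational_combination s| < e.
Proof.
move=> dV x e e0; have e2 : 0 < e / 2 by rewrite divr_gt0.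
have [s xs] := dV x _ e2.
have [t st] : exists t, `|\sum_(p <- s) p.1 *: d p.2 - rational_combination t| < e / 2.
  elim: s {xs} (e / 2) e2 => [|p s IH] r r0.
    by exists [::]; rewrite /rational_combination !big_nil subrr normr0.
  have r2 : 0 < r / 2 by rewrite divr_gt0.
  have [t st] := IH _ r2.
  have n0 : 0 < `|d p.2| + 1 by rewrite ltr_wpDl.
  have b0 : 0 < r / 2 / (`|d p.2| + 1) by rewrite divr_gt0.
  have [q] : exists q : rat, ratr q \in `]p.1, p.1 + r / 2 / (`|d p.2| + 1)[.
    by apply: rat_in_itvoo; rewrite ltrDl.
  rewrite in_itv /= => /andP[pq qp]; exists ((q, p.2) :: t).
  rewrite /rational_combination !big_cons /= opprD addrACA -scalerBl.
  rewrite (le_lt_trans (ler_normD _ _))// (splitr r) ler_ltD// normrZ.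
  rewrite (@le_trans _ _ (r / 2 / (`|d p.2| + 1) * (`|d p.2| + 1)))//.
    apply: ler_pM => //; last by rewrite lerDl.
    by rewrite distrC gtr0_norm ?subr_gt0// lerBlDl ltW.
  by rewrite divfK// gt_eqF.
exists t; rewrite -(subrKA (\sum_(p <- s) p.1 *: d p.2)).
by rewrite (le_lt_trans (ler_normD _ _))// (splitr e) ltrD.
Qed.

End rational_combinations.

Lemma separable_approx (R : realType) (V : normedModType R) (I : countType) (d : I -> V) :
  (forall x (e : R), 0 < e -> exists i, `|x - d i| < e) -> separable V.
Proof.
move=> dV; exists (range d).
  exact: sub_countable (card_image_le _ _) (countableP _).
move=> O [x Ox] oO.
have /nbhs_ballP[e /= e0 xeO] : nbhs x O by exact: open_nbhs_nbhs (conj oO Ox).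
have [i xi] := dV x e e0; exists (d i); split; last by exists i.
by apply: xeO; rewrite -ball_normE.
Qed.

Section ell2_separable.
Variable R : realType.

Lemma ell2_partial_sum (x : ell2 R) N :
  `|x - \sum_(0 <= k < N) val x k *: ell2_basis R k| ^+ 2 =
    `|x| ^+ 2 - series (fun k => val x k ^+ 2) N /\
  forall k, (N <= k)%N ->
    val (x - \sum_(0 <= j < N) val x j *: ell2_basis R j) k = val x k.
Proof.
elim: N => [|N [IH IHk]].
  by rewrite !big_nil subr0 /series /= big_nil subr0.
rewrite big_nat_recr// opprD addrA -scaleNr; split.
  by rewrite ell2_norm_add_basis IH IHk// /series /= big_nat_recr//=; ring.
move=> k Nk; rewrite ell2_addE ell2_scaleE ell2_basisE gtn_eqF// mulr0 addr0.
by rewrite IHk// ltnW.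
Qed.

Lemma ell2_basis_total (x : ell2 R) (e : R) : 0 < e ->
  exists s : seq (R * nat), `|x - \sum_(p <- s) p.1 *: ell2_basis R p.2| < e.
Proof.
move=> e0; have e20 : 0 < e ^+ 2 by rewrite exprn_gt0.
have /cvgrPdist_lt/(_ _ e20)/filter_ex[N xN] := @ell2_norm_cvg R x.
exists [seq (val x k : R, k) | k <- iota 0 N].
rewrite big_map /= -[X in iota _ X]subn0 -/(index_iota 0 N).
rewrite -(ltr_pXn2r (_ : 0 < 2)%N) ?nnegrE ?(ltW e0)//.
have [-> _] := ell2_partial_sum x N.
by apply: le_lt_trans xN; exact: ler_norm.
Qed.

Definition ell2_rational (s : seq (rat * nat)) : ell2 R :=
  rational_combination (ell2_basis R) s.

Lemma ell2_rational_dense (x : ell2 R) (e : R) : 0 < e ->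
  exists s, `|x - ell2_rational s| < e.
Proof. exact: rational_combination_dense ell2_basis_total x e. Qed.

Lemma ell2_separable : separable (ell2 R).
Proof. exact: separable_approx ell2_rational_dense. Qed.

End ell2_separable.

Section free_space_separable.
Variables (R : realType) (M : metricType R) (o : M) (I : countType) (d : I -> M).
Hypothesis d_dense : forall u (e : R), 0 < e -> exists i, mdist u (d i) < e.

Lemma free_delta_total (mu : free_space o) (e : R) : 0 < e ->
  exists s : seq (R * I), `|mu - \sum_(p <- s) p.1 *: free_delta o (d p.2)| < e.
Proof.
move=> e0; have e2 : 0 < e / 2 by rewrite divr_gt0.
have [s xs] := free_delta_dense mu e2.
have [t st] : exists t : seq (R * I), `|\sum_(p <- s) p.1 *: free_delta o p.2 -
    \sum_(p <- t) p.1 *: free_delta o (d p.2)| < e / 2.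
  elim: s {xs} (e / 2) e2 => [|p s IH] r r0.
    by exists [::]; rewrite !big_nil subrr normr0.
  have r2 : 0 < r / 2 by rewrite divr_gt0.
  have [t st] := IH _ r2.
  have n0 : 0 < `|p.1| + 1 by rewrite ltr_wpDl.
  have b0 : 0 < r / 2 / (`|p.1| + 1) by rewrite divr_gt0.
  have [i pi] := d_dense p.2 b0; exists ((p.1, i) :: t).
  rewrite !big_cons /= opprD addrACA -scalerBr.
  rewrite (le_lt_trans (ler_normD _ _))// (splitr r) ler_ltD// normrZ.
  rewrite norm_free_deltaB (@le_trans _ _ ((`|p.1| + 1) * (r / 2 / (`|p.1| + 1))))//.
    by apply: ler_pM; rewrite ?mdist_ge0 ?lerDl// ltW.
  by rewrite mulrC divfK// gt_eqF.
exists t; rewrite -(subrKA (\sum_(p <- s) p.1 *: free_delta o p.2)).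
apply: le_lt_trans (ler_normD _ _) _; rewrite (splitr e).
exact: ltrD xs st.
Qed.

Lemma free_space_separable : separable (free_space o).
Proof.
apply: (separable_approx (d := rational_combination (fun i => free_delta o (d i)))).
by move=> mu e e0; apply: rational_combination_dense => //; exact: free_delta_total.
Qed.

End free_space_separable.

Section gauge.
Variables (R : realType).

Lemma max_id_sqrt_lt (t e : R) : 0 <= t -> 0 < e -> t < Num.min e (e ^+ 2) ->
  max_id_sqrt t < e.
Proof.
move=> t0 e0; rewrite lt_min gt_max => /andP[-> te] /=.
by rewrite -(ltr_pXn2r (_ : 0 < 2)%N) ?nnegrE ?sqrtr_ge0 ?sqr_sqrtr// ltW.
Qed.

(** For [r = t / eps], this is [r <= omega r <= 1 + r]. *)
Lemma rescaled_gauge (eps t : R) : 0 < eps -> 0 <= t ->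
  0 <= eps * max_id_sqrt (t / eps) - t <= eps.
Proof.
move=> e0 t0; have te : t = eps * (t / eps) by rewrite mulrC divfK// gt_eqF.
have {te} [r -> r0] : exists2 r, t = eps * r & 0 <= r.
  by exists (t / eps) => //; rewrite divr_ge0// ltW.
rewrite mulrAC mulfV ?gt_eqF// mul1r -mulrBr -{3}[eps]mulr1 mulr_ge0 ?(ltW e0)//=.
  rewrite ler_pM2l// lerBlDr; exact: max_id_sqrt_le.
by rewrite subr_ge0 max_id_sqrt_ge.
Qed.

End gauge.

Section almost_isometry.
Variables (R : realType) (V : normedModType R).
Local Notation M := (remetrized (@max_id_sqrt_metric R V)).
Local Notation o := (0 : V).

Definition rescaled_delta (eps : R) (x : V) : free_space (o : M) :=
  eps *: free_delta (o : M) (eps^-1 *: x).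

Variable eps : R.
Hypothesis eps0 : 0 < eps.

Lemma norm_rescaled_deltaB x y :
  `|rescaled_delta eps x - rescaled_delta eps y| = eps * max_id_sqrt (`|x - y| / eps).
Proof.
rewrite /rescaled_delta -scalerBr normrZ gtr0_norm//; congr (_ * _).
rewrite norm_free_deltaB mdistE -scalerBr normrZ gtr0_norm ?invr_gt0//.
by rewrite mulrC.
Qed.

Lemma rescaled_delta_bounds x y :
  0 <= `|rescaled_delta eps x - rescaled_delta eps y| - `|x - y| <= eps.
Proof. by rewrite norm_rescaled_deltaB rescaled_gauge. Qed.

Lemma rescaled_delta_expands x y :
  `|x - y| <= `|rescaled_delta eps x - rescaled_delta eps y|.
Proof. by have /andP[+ _] := rescaled_delta_bounds x y; rewrite subr_ge0. Qed.

Lemma rescaled_delta_inj : injective (rescaled_delta eps).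
Proof.
move=> x y xy; apply/eqP; rewrite -subr_eq0 -normr_le0.
by rewrite (le_trans (rescaled_delta_expands x y))// xy subrr normr0.
Qed.

Lemma rescaled_delta_unif_continuous : unif_continuous (rescaled_delta eps).
Proof.
apply/unif_continuousP => e e0 /=.
have e1 : 0 < e / eps by rewrite divr_gt0.
exists (Num.min (e / eps) ((e / eps) ^+ 2) * eps).
  by rewrite /= mulr_gt0// lt_min e1 exprn_gt0.
move=> [x y] /=; rewrite -!ball_normE /= norm_rescaled_deltaB => xy.
rewrite mulrC -ltr_pdivlMr//; apply: max_id_sqrt_lt => //.
  by rewrite divr_ge0// ltW.
by rewrite ltr_pdivrMr.
Qed.

(** On the range, the inverse is 1-Lipschitz because the map does not decrease
distances; elsewhere its values are arbitrary. *)
Lemma rescaled_delta_inverse : exists2 g : free_space (o : M) -> V,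
  cancel (rescaled_delta eps) g & 1.-lipschitz_(range (rescaled_delta eps)) g.
Proof.
pose g z := xget o [set x | rescaled_delta eps x = z].
have gK : cancel (rescaled_delta eps) g.
  move=> x; apply: rescaled_delta_inj.
  exact: (@xgetPex _ o [set y | rescaled_delta eps y = rescaled_delta eps x]
    (ex_intro _ x erefl)).
exists g => //; move=> [a b] /= [[x _ <-] [y _ <-]].
by rewrite !gK mul1r rescaled_delta_expands.
Qed.

End almost_isometry.

(** * The pair of l2 and its free space *)

(** Both sides are convertible, but the rewriting spares the unifier a costly
comparison of normed structures. *)
Lemma F_omega_ell2E (R : realType) :
  F_omega_ell2 R =
  (free_space ((0 : ell2 R) : remetrized (@max_id_sqrt_metric R (ell2 R))) :
     completeNormedModType R).
Proof. by []. Qed.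

Lemma F_omega_ell2_separable (R : realType) : separable (F_omega_ell2 R).
Proof.
apply: (@free_space_separable R (remetrized (@max_id_sqrt_metric R (ell2 R))) 0
  _ (@ell2_rational R)) => u e e0.
have m0 : 0 < Num.min e (e ^+ 2) by rewrite lt_min e0 exprn_gt0.
have [s us] := @ell2_rational_dense R u _ m0; exists s; rewrite mdistE.
exact: max_id_sqrt_lt.
Qed.

Lemma F_omega_ell2_almost_isometric (R : realType) :
  almost_isometric_injections (ell2 R) (F_omega_ell2 R).
Proof.
move=> eps eps0; exists (@rescaled_delta R (ell2 R) eps); split.
- exact: rescaled_delta_inj.
- exact: rescaled_delta_bounds.
- exact: rescaled_delta_unif_continuous.
- exact: rescaled_delta_inverse.
Qed.

Lemma F_omega_ell2_no_isometry (R : realType) :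
  ~ exists g : ell2 R -> F_omega_ell2 R, isometric_embedding g.
Proof. by rewrite F_omega_ell2E => -[g gI]; exact: (@no_isometry R g gI). Qed.

Theorem theorem1p5 (R : realType) :
  (exists X Y : completeNormedModType R,
    [/\ separable X, separable Y,
        almost_isometric_injections X Y &
        ~ exists g : X -> Y, isometric_embedding g])
  /\
  [/\ separable (ell2 R), separable (F_omega_ell2 R),
      almost_isometric_injections (ell2 R) (F_omega_ell2 R) &
      ~ exists g : ell2 R -> F_omega_ell2 R, isometric_embedding g].
Proof.
have pair : [/\ separable (ell2 R), separable (F_omega_ell2 R),
    almost_isometric_injections (ell2 R) (F_omega_ell2 R) &
    ~ exists g : ell2 R -> F_omega_ell2 R, isometric_embedding g].
  split; [exact: ell2_separable|exact: F_omega_ell2_separable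
    |exact: F_omega_ell2_almost_isometric|exact: F_omega_ell2_no_isometry].
by split=> //; exists (ell2 R), (F_omega_ell2 R).
Qed.
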